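(* Let the loss function $L(\cdot,\cdot)$ be Lipschitz in its second argument (in trace norm, uniformly in the first argument) with constant $L_0$. Let $m\ge1$, let $\bullet\in\{\mathrm w,\mathrm a\}$ denote worst-case or average risk, let $\mathcal L^{\ast}_{\bullet,\mathrm{one}}$ be the optimal one-site risk over symmetric $1\to m$ protocols (exchange-invariant, respectively bosonic, on their $m$ outputs), and let $\widetilde{\mathcal L}^{\ast}_{\bullet}$ be the optimal risk over entanglement-breaking channels $\mathcal B(\mathbb H_A)\to\mathcal B(\mathbb H_{B_1})$. Then $$\mathcal L^{\ast}_{\bullet,\mathrm{one}}\;\le\;\widetilde{\mathcal L}^{\ast}_{\bullet}\;\le\;\mathcal L^{\ast}_{\bullet,\mathrm{one}}+L_0\,d_A\,\varepsilon_m,$$ where $\varepsilon_m=\frac{2d_B^3}{m}$ in the general exchange-invariant case and $\varepsilon_m=\frac{2d_B^2}{m}$ in the case of bosonic outputs.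
   Context: All Hilbert spaces are finite dimensional: $\mathbb H_A=\mathbb C^{d_A}$ and $\mathbb H_{B_i}\cong\mathbb C^{d_B}$. A $1\to m$ protocol is a channel $\mathcal T:\mathcal B(\mathbb H_A)\to\mathcal B(\mathbb H_{B_1}\otimes\cdots\otimes\mathbb H_{B_m})$. It is exchange-invariant if its Choi matrix is invariant under conjugation by every permutation unitary of $B_1,\dots,B_m$; it is bosonic if its output is supported on the totally symmetric subspace of $\mathbb H_B^{\otimes m}$. A channel is entanglement-breaking iff its Choi matrix is separable across the input-output cut. Inference task: $\mathcal X$ is a set of density operators on $\mathbb H_A$ (with a prior probability measure $\pi$ for average risks), $\gamma(\Sigma)$ is a target density operator on $\mathbb C^{d_B}$ for each $\Sigma\in\mathcal X$, and $L$ is a real-valued loss. The Lipschitz condition reads $|L(\gamma(\Sigma),\tau)-L(\gamma(\Sigma),\tau')|\le L_0\|\tau-\tau'\|_1$ for all $\Sigma\in\mathcal X$ and all density operators $\tau,\tau'$. For a single-output channel $\mathcal S$: $\mathcal L_{\mathrm w}(\mathcal S)=\sup_{\Sigma\in\mathcal X}L(\gamma(\Sigma),\mathcal S(\Sigma))$ and $\mathcal L_{\mathrm a}(\mathcal S)=\int_{\mathcal X}L(\gamma(\Sigma),\mathcal S(\Sigma))\,d\pi(\Sigma)$. For an exchange-invariant or bosonic $m$-output protocol all one-site marginals coincide, and the one-site risk $\mathcal L_{\bullet,\mathrm{one}}(\mathcal T)$ is $\mathcal L_\bullet$ of the marginal channel $\Sigma\mapsto\operatorname{Tr}_{B_2\cdots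 B_m}\mathcal T(\Sigma)$. $\mathcal L^\ast_{\bullet,\mathrm{one}}$ is the infimum of $\mathcal L_{\bullet,\mathrm{one}}$ over all exchange-invariant (respectively bosonic) $1\to m$ protocols, and $\widetilde{\mathcal L}^\ast_\bullet$ is the infimum of $\mathcal L_\bullet$ over entanglement-breaking channels. *)

(* Defs.v *)
(* MathComp, MathComp-Analysis and real-closed (R[i] over an abstract realType) *)
From HB Require Import structures.
From mathcomp Require Import all_boot all_order all_algebra.
From mathcomp Require Import fingroup perm sesquilinear spectral.
From mathcomp Require Import all_classical all_reals all_analysis.
From mathcomp Require Import complex.
(* not imported: its notation A ^t k clashes with the one of sesquilinear *)
From mathcomp Require mxtens.

Set Implicit Arguments.
Unset Strict Implicit.
Unset Printing Implicit Defensive.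

Import Order.TTheory GRing.Theory Num.Theory.
Import numFieldNormedType.Exports.

Local Open Scope classical_set_scope.
Local Open Scope ring_scope.
Local Open Scope complex_scope.
Local Open Scope sesquilinear_scope.

Notation tens := mxtens.tensmx.
Notation tens_index := mxtens.mxtens_index.

(* sigma-algebras are defined on pointed types *)
HB.instance Definition _ (R : realType) := isPointed.Build R[i] 0.

Section Operators.
Variable R : realType.
Local Notation C := R[i].

(* In the partial order of C, 0 <= z means that z is real and nonnegative;
   hence positive semidefinite operators are Hermitian. *)
Definition psd n (A : 'M[C]_n) : Prop :=
  forall v : 'cV[C]_n, 0 <= (v ^t* *m A *m v) 0 0.

Definition density n : set 'M[C]_n := [set A | psd A /\ \tr A = 1].

(* Tr |A|: the sum of the square roots of the eigenvalues, with multiplicity,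
   of the (Hermitian) operator A^* A. *)
Definition trace_norm n (A : 'M[C]_n) : R :=
  complex.Re (\sum_(i < n) sqrtC (spectral_diag (A ^t* *m A) 0 i)).

Definition block k n (X : 'M[C]_(k * n)) (i j : 'I_k) : 'M[C]_n :=
  \matrix_(a, b) X (tens_index (i, a)) (tens_index (j, b)).

(* id_k (x) T, for a map T assumed to be linear *)
Definition ampliation k n p (T : 'M[C]_n -> 'M[C]_p) (X : 'M[C]_(k * n)) :
    'M[C]_(k * p) :=
  \sum_(i < k) \sum_(j < k) tens (delta_mx i j) (T (block X i j)).

Definition completely_positive n p (T : 'M[C]_n -> 'M[C]_p) : Prop :=
  forall (k : nat) (X : 'M[C]_(k * n)), psd X -> psd (ampliation T X).

Definition trace_preserving n p (T : 'M[C]_n -> 'M[C]_p) : Prop :=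
  forall X : 'M[C]_n, \tr (T X) = \tr X.

Definition channel n p : set ('M[C]_n -> 'M[C]_p) :=
  [set T | [/\ linear T, completely_positive T & trace_preserving T]].

(* Unnormalised: the trace of the Choi matrix of a channel is n. *)
Definition choi n p (T : 'M[C]_n -> 'M[C]_p) : 'M[C]_(n * p) :=
  \sum_(i < n) \sum_(j < n) tens (delta_mx i j) (T (delta_mx i j)).

(* The weights are nonnegative but need not sum to 1, as separability is
   applied to unnormalised Choi matrices. *)
Definition separable n p (M : 'M[C]_(n * p)) : Prop :=
  exists (N : nat) (w : 'I_N -> C)
         (rho : 'I_N -> 'M[C]_n) (sigma : 'I_N -> 'M[C]_p),
    [/\ forall k, 0 <= w k, forall k, density (rho k),
        forall k, density (sigma k) &
        M = \sum_(k < N) w k *: tens (rho k) (sigma k)].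

Definition eb_channel n p : set ('M[C]_n -> 'M[C]_p) :=
  [set S | channel S /\ separable (choi S)].

End Operators.

(* The space (C^d)^{(x) m} has the basis |x>, x : {ffun 'I_m -> 'I_d}; the
   matrix index of |x> is enum_rank x. *)
Notation sites m d := {ffun 'I_m -> 'I_d}.
Notation tdim m d := #|{: sites m d}|.

Section Multipartite.
Variables (R : realType) (m d : nat).
Local Notation C := R[i].

(* The unitary permuting the tensor factors: |x> is sent to |x o s^-1>. *)
Definition site_perm (s : 'S_m) : 'M[C]_(tdim m d) :=
  \matrix_(a, b)
    ([ffun k => (enum_val a : sites m d) (s k)] == enum_val b :> sites m d)%:R.

Definition set_site (x : sites m d) (i : 'I_m) (b : 'I_d) : sites m d :=
  [ffun k => if k == i then b else x k].

(* Partial trace over all the sites other than i. *)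
Definition marginal (i : 'I_m) (M : 'M[C]_(tdim m d)) : 'M[C]_d :=
  \matrix_(a, b) \sum_(x : sites m d | x i == a)
    M (enum_rank x) (enum_rank (set_site x i b)).

Definition symmetric_vector (v : 'cV[C]_(tdim m d)) : Prop :=
  forall s : 'S_m, site_perm s *m v = v.

(* For a Hermitian operator the support is the range. *)
Definition supported_on_symmetric (M : 'M[C]_(tdim m d)) : Prop :=
  forall v : 'cV[C]_(tdim m d), symmetric_vector (M *m v).

Definition exchange_invariant n (T : 'M[C]_n -> 'M[C]_(tdim m d)) : Prop :=
  forall s : 'S_m,
    let U := tens (1%:M : 'M[C]_n) (site_perm s) in
    U *m choi T *m U ^t* = choi T.

Definition bosonic n (T : 'M[C]_n -> 'M[C]_(tdim m d)) : Prop :=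
  forall rho : 'M[C]_n, density rho -> supported_on_symmetric (T rho).

End Multipartite.

Inductive output_symmetry := ExchangeInvariant | Bosonic.

Definition protocol (R : realType) (sym : output_symmetry) (m dA dB : nat) :
    set ('M[R[i]]_dA -> 'M[R[i]]_(tdim m dB)) :=
  [set T | channel T /\
    match sym with
    | ExchangeInvariant => exchange_invariant T
    | Bosonic => bosonic T
    end].

Definition epsilon (R : realType) (sym : output_symmetry) (m dB : nat) : R :=
  match sym with
  | ExchangeInvariant => 2 * dB%:R ^+ 3 / m%:R
  | Bosonic => 2 * dB%:R ^+ 2 / m%:R
  end.

(* The prior of an average risk is a probability measure on an arbitrary
   sigma-algebra of the matrix space, given by a generating family G. *)
Inductive criterion (R : realType) (dA : nat) :=
  | WorstCase
  | Average (G : set (set 'M[R[i]]_dA))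
            (prior : probability (g_sigma_algebraType G) R).

Section Risk.
Variables (R : realType) (dA dB : nat).
Local Notation C := R[i].
Variables (X : set 'M[C]_dA) (gamma : 'M[C]_dA -> 'M[C]_dB).
Variable L : 'M[C]_dB -> 'M[C]_dB -> R.

Definition lipschitz_loss (L0 : R) : Prop :=
  forall Sigma, X Sigma ->
  forall tau tau' : 'M[C]_dB, density tau -> density tau' ->
    `|L (gamma Sigma) tau - L (gamma Sigma) tau'| <= L0 * trace_norm (tau - tau').

(* For an average risk: the prior is carried by X, and the integrand of the
   risk of every channel is measurable. *)
Definition admissible (c : criterion R dA) : Prop :=
  match c with
  | WorstCase => True
  | @Average _ _ G prior =>
      [/\ measurable (X : set (g_sigma_algebraType G)), prior X = 1%E &
          forall S : 'M[C]_dA -> 'M[C]_dB, channel S ->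
            measurable_fun (X : set (g_sigma_algebraType G))
              (fun Sigma => L (gamma Sigma) (S Sigma))]
  end.

Definition risk (c : criterion R dA) (S : 'M[C]_dA -> 'M[C]_dB) : \bar R :=
  match c with
  | WorstCase => ereal_sup [set (L (gamma Sigma) (S Sigma))%:E | Sigma in X]
  | @Average _ _ _ prior =>
      (\int[prior]_(Sigma in X) (L (gamma Sigma) (S Sigma))%:E)%E
  end.

Definition one_site_risk (c : criterion R dA) m (i : 'I_m)
    (T : 'M[C]_dA -> 'M[C]_(tdim m dB)) : \bar R :=
  risk c (fun Sigma => marginal i (T Sigma)).

Definition optimal_one_site_risk (c : criterion R dA)
    (sym : output_symmetry) m (i : 'I_m) : \bar R :=
  ereal_inf [set one_site_risk c i T | T in @protocol R sym m dA dB].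

Definition optimal_eb_risk (c : criterion R dA) : \bar R :=
  ereal_inf [set risk c S | S in @eb_channel R dA dB].

End Risk.

(* Main.v *)
Require Import Defs.
From HB Require Import structures.
From mathcomp Require Import all_boot all_order all_algebra.
From mathcomp Require Import fingroup perm cyclic sesquilinear spectral.
From mathcomp Require Import all_classical all_reals all_analysis.
From mathcomp Require Import measurable_realfun complex.
From mathcomp Require Import ring lra.
From mathcomp Require mxtens separable cyclotomic.

(** The first inequality: an entanglement-breaking channel measures its input
    and prepares pure states psi; preparing psi^{(x) m} instead gives a protocol
    that is both exchange-invariant and bosonic and has the same marginals.

    The second inequality: if T has outputs in the symmetric subspace of
    (C^D)^{(x) m}, measuring T(rho) with the Gaussian (coherent state)
    resolution of the identity of that subspace and preparing the outcome
    gives an entanglement-breaking channel, and Wick's theorem computes it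
    as rho |-> (tr(rho) 1 + m T_1(rho)) / (m + D), with T_1 the one-site
    marginal of T.  The Gaussian measure is replaced by a finite design with
    the same moments up to the required degree: phases are roots of unity and
    squared moduli are Gauss-Laguerre nodes, so that separability is a finite
    sum.  An exchange-invariant T is first dilated to (C^d (x) C^d)^{(x) m}
    by means of the positive square root of its Choi matrix, which inherits
    the permutation invariance.  The trace norm of the d x d difference is
    bounded crudely by d times its Hilbert-Schmidt norm. *)

Set Implicit Arguments.
Unset Strict Implicit.
Unset Printing Implicit Defensive.

Import Order.TTheory GRing.Theory Num.Theory.
Import numFieldNormedType.Exports.

Local Open Scope classical_set_scope.
Local Open Scope ring_scope.
Local Open Scope sesquilinear_scope.

(** * Positive forms *)

Section Hermitian.
Variable C : numClosedFieldType.

Lemma mxE_trC m n (A : 'M[C]_(m, n)) i j : (A ^t*) i j = (A j i)^*.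
Proof. by rewrite !mxE. Qed.

Lemma trC_mul m n p (A : 'M[C]_(m, n)) (B : 'M[C]_(n, p)) :
  (A *m B) ^t* = B ^t* *m A ^t*.
Proof. by rewrite trmx_mul map_mxM. Qed.

Lemma sum_delta (I : finType) (V : pzSemiRingType) (k : I) (F : I -> V) :
  \sum_i (i == k)%:R * F i = F k.
Proof.
rewrite (bigD1 k) //= eqxx mul1r big1 ?addr0 // => i /negPf ->.
by rewrite mul0r.
Qed.

Lemma quad_formE n (A : 'M[C]_n) (v : 'cV[C]_n) :
  (v ^t* *m A *m v) 0 0 = \sum_i \sum_j (v i 0)^* * A i j * v j 0.
Proof.
rewrite mxE exchange_big /=; apply: eq_bigr => j _.
by rewrite mxE mulr_suml; apply: eq_bigr => i _; rewrite !mxE.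
Qed.

(** Polarisation: the form is real on the vectors [x e_i + y e_j], and the choices [(1, 1)] and
    [(1, 'i)] make [A i j + A j i] and ['i * (A i j - A j i)] real, which forces conjugate
    entries. *)
Lemma quad_form_ge0_herm n (A : 'M[C]_n) :
  (forall v : 'cV[C]_n, 0 <= (v ^t* *m A *m v) 0 0) -> A ^t* = A.
Proof.
move=> A_ge0; apply/matrixP => i j; rewrite mxE_trC.
pose v (x y : C) (k l : 'I_n) : 'cV[C]_n := x *: delta_mx k 0 + y *: delta_mx l 0.
have qf (x y : C) (k l : 'I_n) : ((v x y k l) ^t* *m A *m v x y k l) 0 0 =
    x^* * x * A k k + x^* * y * A k l + y^* * x * A l k + y^* * y * A l l.
  have vu (u : 'cV[C]_n) : ((v x y k l) ^t* *m u) 0 0 = x^* * u k 0 + y^* * u l 0.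
    rewrite mxE -[u k 0](sum_delta _ (u^~ 0)) -[u l 0](sum_delta _ (u^~ 0)).
    rewrite !mulr_sumr -big_split; apply: eq_bigr => a _ /=.
    by rewrite !mxE !andbT rmorphD !rmorphM /= !conjC_nat; ring.
  have Av a : (A *m v x y k l) a 0 = x * A a k + y * A a l.
    by rewrite /v mulmxDr -!scalemxAr -!colE !mxE.
  by rewrite -mulmxA vu !Av; ring.
have Akk k : 0 <= A k k.
  have := A_ge0 (v 1 0 k k); rewrite qf.
  by rewrite !(rmorph1, rmorph0, mul0r, mulr0, mul1r, addr0).
have real x y : x^* * y * A i j + y^* * x * A j i \is Num.real.
  have -> : x^* * y * A i j + y^* * x * A j i =
     ((v x y i j) ^t* *m A *m v x y i j) 0 0
     - (x * x^* * A i i + y * y^* * A j j) by rewrite qf; ring.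
  rewrite rpredB ?ger0_real // addr_ge0 // mulr_ge0 // mul_conjC_ge0 //.
have := real 1 1; have := real 1 'i; rewrite !rmorph1 !mul1r !mulr1 conjCi.
move=> /CrealP e1 /CrealP e2.
move: e1 e2; rewrite !(rmorphD, rmorphM, rmorphN) /= conjCi => e1 e2.
have {}e1 : - (A i j)^* + (A j i)^* = A i j - A j i.
  apply: (mulfI (neq0Ci C)); move: e1.
  by rewrite opprK => e1; rewrite mulrDr mulrBr mulrN -mulNr e1; ring.
have e : (A j i)^* *+ 2 = A i j *+ 2.
  rewrite [LHS](_ : _ = ((A i j)^* + (A j i)^*) + (- (A i j)^* + (A j i)^*)).
    by rewrite e1 e2; ring.
  by ring.
by apply: (mulIf (_ : 2%:R != 0 :> C)); rewrite ?pnatr_eq0 // !mulr_natr.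
Qed.

(** Hermitian matrices are normal, hence unitarily diagonalisable; the form at the eigenvector
    [Q ^t* *m e] equals the eigenvalue [l 0 i]. *)
Lemma nneg_form_spectral n (A : 'M[C]_n) (Q := spectralmx A) (l := spectral_diag A) :
  (forall v : 'cV[C]_n, 0 <= (v ^t* *m A *m v) 0 0) ->
  [/\ Q *m Q ^t* = 1%:M, Q ^t* *m Q = 1%:M, forall i, 0 <= l 0 i &
      A = Q ^t* *m diag_mx l *m Q].
Proof.
move=> A_ge0; have Ah := quad_form_ge0_herm A_ge0.
have /orthomx_spectralP : A \is normalmx by apply/normalmxP; rewrite Ah.
have Qu := spectral_unitarymx A; have := invmx_unitary Qu.
have := unitarymx_unit Qu; have /unitarymxP := Qu.
rewrite -/Q -/l => QQ Qunit Qinv eA.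
rewrite Qinv in eA; split=> // [|i]; first by rewrite -Qinv mulVmx.
pose e : 'cV[C]_n := delta_mx i 0.
have := A_ge0 (Q ^t* *m e).
have -> : (Q ^t* *m e) ^t* *m A *m (Q ^t* *m e) = e ^t* *m diag_mx l *m e.
  rewrite eA trC_mul trmxCK !mulmxA -(mulmxA _ Q) QQ mulmx1.
  by rewrite -(mulmxA _ Q) QQ mulmx1.
rewrite quad_formE (bigD1 i) //=.
rewrite [X in _ + X]big1 ?addr0 => [|j /negPf ji]; last first.
  by apply: big1 => k _; rewrite !mxE ji rmorph0 !mul0r.
rewrite (bigD1 i) //= big1 ?addr0 => [|j /negPf ji]; last first.
  by rewrite !mxE ji mulr0.
by rewrite !mxE !eqxx rmorph1 mulr1 mul1r.
Qed.

(** [K] is the positive square root. In the eigenbasis, a matrix commuting with [A] vanishes between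
    distinct eigenvalues, so it also commutes with [K]. This is how permutation invariance passes
    from a Choi matrix to its root. *)
Lemma nneg_form_sqrt n (A : 'M[C]_n) :
  (forall v : 'cV[C]_n, 0 <= (v ^t* *m A *m v) 0 0) ->
  exists2 K : 'M[C]_n, A = K *m K ^t* &
    forall P : 'M[C]_n, P *m A = A *m P -> P *m K = K *m P.
Proof.
move=> /nneg_form_spectral[].
move: (spectralmx A) (spectral_diag A) => Q l QQ QQ' l_ge0 eA.
pose s : 'rV[C]_n := \row_i sqrtC (l 0 i).
have diagC (B : 'M[C]_n) (d : 'rV[C]_n) i j :
  ((diag_mx d *m B) i j = d 0 i * B i j) * ((B *m diag_mx d) i j = B i j * d 0 j).
  by rewrite mul_diag_mx mul_mx_diag !mxE.
have ss : diag_mx s *m diag_mx s = diag_mx l.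
  apply/matrixP => i j; rewrite diagC !mxE mulrnAr -expr2 sqrtCK //.
have sC : (diag_mx s) ^t* = diag_mx s.
  apply/matrixP => i j; rewrite !mxE eq_sym rmorphMn /=.
  by case: eqP => [->|]; rewrite ?mulr0n // geC0_conj // sqrtC_ge0.
exists (Q ^t* *m diag_mx s *m Q).
  rewrite !trC_mul trmxCK sC !mulmxA -(mulmxA _ Q) QQ mulmx1.
  by rewrite -(mulmxA _ (diag_mx s) (diag_mx s)) ss.
move=> P PA.
have {}PA : (Q *m P *m Q ^t*) *m diag_mx l = diag_mx l *m (Q *m P *m Q ^t*).
  have := congr1 (fun X => Q *m X *m Q ^t*) PA; rewrite eA !mulmxA QQ mul1mx.
  by rewrite -!(mulmxA _ Q (Q ^t*)) QQ !mulmx1.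
have {}PA : (Q *m P *m Q ^t*) *m diag_mx s = diag_mx s *m (Q *m P *m Q ^t*).
  apply/matrixP => i j; move/matrixP/(_ i j): PA; rewrite !diagC !mxE.
  have [->|lij] := eqVneq (l 0 i) (l 0 j); first by move=> _; rewrite mulrC.
  rewrite mulrC => /eqP; rewrite -subr_eq0 -mulrBl mulf_eq0 subr_eq0.
  by rewrite eq_sym (negPf lij) /= => /eqP ->; rewrite mul0r mulr0.
have := congr1 (fun X => Q ^t* *m X *m Q) PA; rewrite !mulmxA QQ' mul1mx.
by rewrite -(mulmxA _ (Q ^t*) Q) QQ' mulmx1 => <-.
Qed.

End Hermitian.

(** * Gaussian designs and Wick's theorem *)

Section Quadrature.
Variable C : numClosedFieldType.

Lemma laguerre_quadrature N : exists (w t : 'I_N.+1 -> C),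
  [/\ forall i, 0 <= w i, forall i, 0 <= t i &
      forall k, (k <= N)%N -> \sum_i w i * t i ^+ k = (k`!)%:R].
Proof.
(* J is the Jacobi matrix of the Laguerre polynomials.  The coordinates of
   J^k e_0 are k! 'C(k, _), hence the spectral measure of J at e_0 has k-th
   moment k!. *)
pose u (n : 'I_N.+1) : 'cV[C]_N.+1 := \col_i ((i == n)%:R + (i == n.+1 :> nat)%:R).
(* A sum of positive rank-one terms, so the nodes, its eigenvalues, are nonnegative. Truncation
   reduces the last [u] to a single basis vector. *)
pose J : 'M[C]_N.+1 := \sum_(n < N.+1) n.+1%:R *: (u n *m (u n)^t*).
have J_ge0 (v : 'cV[C]_N.+1) : 0 <= (v ^t* *m J *m v) 0 0.
  rewrite mulmx_sumr mulmx_suml summxE sumr_ge0 // => n _.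
  rewrite -scalemxAr -scalemxAl mxE mulr_ge0 ?ler0n // mulmxA.
  rewrite -(mulmxA _ _ v) mxE big_ord1.
  have -> : ((u n)^t* *m v) 0 0 = ((v ^t* *m u n) 0 0)^*.
    by rewrite -mxE_trC trC_mul trmxCK.
  exact: mul_conjC_ge0.
have [] := nneg_form_spectral J_ge0.
move: (spectralmx J) (spectral_diag J) => Q l QQ QQ' l_ge0 eJ.
pose c k : 'cV[C]_N.+1 := \col_i (k`! * 'C(k, i))%:R.
(* Pascal's rule applies twice: to pair [u n] with [c k], then to recombine the [u n]. Since
   [k < N], the term ['C(k, N.+1)] missing from the truncated [u N] is zero. *)
have Jc k : (k < N)%N -> J *m c k = c k.+1.
  move=> kN; apply/matrixP => i j; rewrite ord1 {j}.
  have uc (n : 'I_N.+1) : ((u n)^t* *m c k) 0 0 = (k`! * 'C(k.+1, n.+1))%:R.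
    rewrite binS mulnDr addnC natrD mxE.
    under eq_bigr do rewrite !mxE rmorphD /= !conjC_nat mulrDl.
    rewrite big_split /= sum_delta; congr (_ + _).
    have [nN|nN] := ltnP n N; last first.
      rewrite bin_small ?(leq_trans kN) ?(leq_trans nN) // muln0.
        by apply: big1 => a _; rewrite (ltn_eqF (leq_trans (ltn_ord a) _)) ?mul0r.
    have nN1 : (n.+1 < N.+1)%N by [].
    rewrite -[RHS](sum_delta (Ordinal nN1) (fun a : 'I_N.+1 => (k`! * 'C(k, a))%:R)).
    by [].
  rewrite mulmx_suml summxE.
  under eq_bigr => n _.
    rewrite -scalemxAl -mulmxA mxE [X in _ * X]mxE big_ord1 uc mxE.
    rewrite mulrCA -natrM mulnCA -mul_bin_diag mulnCA mulnA -factS.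
  over.
  under eq_bigr do rewrite mulrDl.
  rewrite big_split /= mxE.
  under eq_bigr do rewrite eq_sym.
  rewrite sum_delta.
  case: i => [[|i] iN] /=.
    rewrite big1 ?addr0 ?bin0 // => n _; by rewrite mul0r.
  have iN' : (i < N.+1)%N by rewrite ltnW.
  have -> : \sum_(n < N.+1) (i.+1 == n.+1)%:R * ((k.+1)`! * 'C(k, n))%:R =
      ((k.+1)`! * 'C(k, i))%:R :> C.
    rewrite -[RHS](sum_delta (Ordinal iN')
      (fun n : 'I_N.+1 => ((k.+1)`! * 'C(k, n))%:R)).
    by apply: eq_bigr => n _; rewrite eqSS eq_sym.
  by rewrite -natrD -mulnDr -binS.
have Qc k : (k <= N)%N -> forall i, (Q *m c k) i 0 = l 0 i ^+ k * (Q *m c 0%N) i 0.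
  elim: k => [|k IHk] kN i; first by rewrite expr0 mul1r.
  rewrite -Jc // eJ !mulmxA QQ mul1mx -mulmxA mul_diag_mx mxE IHk ?(ltnW kN) //.
  by rewrite exprS mulrA.
(* As [c 0] is the first basis vector, the weights are the squared moduli of its coordinates in the
   eigenbasis. *)
exists (fun i => (Q *m c 0%N) i 0 * ((Q *m c 0%N) i 0)^*), (fun i => l 0 i).
split=> // [i|k kN]; first exact: mul_conjC_ge0.
have : (c k) 0 0 = (k`!)%:R by rewrite mxE bin0 muln1.
rewrite -[c k]mul1mx -QQ' -mulmxA mxE => <-; apply: eq_bigr => i _.
have Q0 : (Q *m c 0%N) i 0 = Q i 0.
  have -> : c 0%N = delta_mx 0 0.
    by apply/matrixP => a b; rewrite !mxE ord1 mul1n bin0n andbT.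
  by rewrite -colE mxE.
by rewrite (Qc k kN) !Q0 mxE_trC; ring.
Qed.

(** In characteristic zero ['X^n - 1] is separable, so it has [n] distinct roots, and [n] distinct
    [n]-th roots of unity include a primitive one. *)
Lemma primitive_root_exists n : (0 < n)%N -> exists z : C, n.-primitive_root z.
Proof.
move=> n_gt0; pose p : {poly C} := 'X^n - 1.
have [r Dp] := closed_field_poly_normal p.
rewrite (monicP _) ?monicXnsubC // scale1r in Dp.
have rn1 : all n.-unity_root r.
  by apply/allP => z; rewrite -root_prod_XsubC -Dp.
have sz_r : (n < (size r).+1)%N.
  by rewrite -(size_prod_XsubC r id) -Dp size_XnsubC.
have [|z] := hasP (has_prim_root n_gt0 rn1 _ sz_r); last by exists z.
rewrite -separable.separable_prod_XsubC -Dp cyclotomic.separable_Xn_sub_1 //.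
by rewrite pnatr_eq0 -lt0n.
Qed.

(** The squared modulus of a standard complex Gaussian is exponential, with moments [a!], which the
    Laguerre nodes reproduce. Averaging the phase over the roots of unity of order [N.+1] removes
    the terms with [a != b], since both exponents are at most [N]. *)
Lemma gaussian_moments N : exists (I : finType) (w : I -> C) (u : I -> C),
  (forall i, 0 <= w i) /\
  forall a b, (a <= N)%N -> (b <= N)%N ->
    \sum_i w i * u i ^+ a * (u i)^* ^+ b = ((a == b) * a`!)%:R.
Proof.
have [w [t [w_ge0 t_ge0 wt]]] := laguerre_quadrature N.
have [z pz] := primitive_root_exists (ltn0Sn N).
have zz : z * z^* = 1.
  have : `|z| ^+ N.+1 == 1 by rewrite -normrX (prim_expr_order pz) normr1.
  by rewrite pexpr_eq1 // => /eqP z1; rewrite -normCK z1 expr1n.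
exists ('I_N.+1 * 'I_N.+1)%type, (fun k => w k.1 / N.+1%:R),
  (fun k : 'I_N.+1 * 'I_N.+1 => sqrtC (t k.1) * z ^+ k.2).
split=> [k|a b aN bN]; first by rewrite divr_ge0 ?ler0n.
rewrite -(pair_bigA _ (fun i j : 'I_N.+1 => w i / N.+1%:R * (sqrtC (t i) * z ^+ j) ^+ a
  * (sqrtC (t i) * z ^+ j)^* ^+ b)) /=.
pose y := z ^+ a * z^* ^+ b.
have phase : \sum_(j < N.+1) y ^+ j = ((a == b) * N.+1)%:R.
  have [eab|nab] := eqVneq a b.
    rewrite /y eab -exprMn zz expr1n mul1n.
    by under eq_bigr do rewrite expr1n; rewrite sumr_const card_ord.
  have y1 : y != 1.
    apply: contra nab => /eqP y1.
    have : z ^+ a = z ^+ b.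
      by rewrite -[RHS]mul1r -y1 /y -mulrA -exprMn [z^* * z]mulrC zz expr1n mulr1.
    by move/eqP; rewrite (eq_prim_root_expr pz) !modn_small.
  (* Here [y != 1] but [y ^+ N.+1 = 1], so the geometric sum is zero. *)
  apply/eqP; rewrite mul0n -(mulrI_eq0 _ (lregP (_ : y - 1 != 0))) ?subr_eq0 //.
  rewrite -subrX1 subr_eq0 /y exprMn -!exprM mulnC exprM.
  by rewrite [(b * _)%N]mulnC exprM -rmorphXn (prim_expr_order pz) rmorph1 !expr1n mulr1.
transitivity (\sum_i w i * t i ^+ a * (a == b)%:R).
  apply: eq_bigr => i _.
  transitivity (\sum_(j < N.+1) w i / N.+1%:R * (sqrtC (t i) ^+ (a + b)) * y ^+ j).
    apply: eq_bigr => j _; rewrite rmorphM rmorphXn /=.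
    rewrite (geC0_conj (_ : 0 <= sqrtC (t i))) ?sqrtC_ge0 // !exprMn exprD.
    by rewrite -!exprM [(b * j)%N]mulnC [(a * j)%N]mulnC; ring.
  rewrite -mulr_sumr phase natrM.
  have N0 : N.+1%:R != 0 :> C by rewrite pnatr_eq0.
  case: eqP => [<-|_]; last by rewrite mul0r !mulr0.
  by rewrite addnn -mul2n exprM sqrtCK mul1r mulr1 mulrAC divfK.
by rewrite -mulr_suml wt // natrM mulrC.
Qed.

End Quadrature.

(** * Combinatorics of Wick pairings *)

Section Wick.
Variable D : finType.
Implicit Types s t : seq D.

(* The Gaussian moment E[\prod_(j <- s) z_j \prod_(j <- t) z_j^*] of
   independent standard complex Gaussian variables z_j. *)
Definition wick s t : nat :=
  (perm_eq s t * \prod_(j : D) (count_mem j s)`!)%N.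

(** The conjugate variable of [b] is contracted with any one of the occurrences of [b] in [s]; both
    sides vanish if there is none. *)
Lemma wick_cons s b t : wick s (b :: t) = (count_mem b s * wick (rem b s) t)%N.
Proof.
rewrite /wick; have [bs|bs] := boolP (b \in s); last first.
  rewrite (count_memPn bs) mul0n; case: perm_eq (@perm_mem _ s (b :: t)) => //.
  by move=> /(_ isT b); rewrite mem_head (negPf bs).
have ps := perm_to_rem bs.
rewrite (permPl ps) perm_cons mulnCA; congr (_ * _)%N.
rewrite (bigD1 b) // [in RHS](bigD1 b) //= (seq.permP ps) /= eqxx add1n factS mulnA.
congr (_ * _)%N; apply: eq_bigr => j /negPf jb.
by rewrite (seq.permP ps) /= eq_sym jb.
Qed.

Lemma sum_count_mem s : \sum_(b : D) count_mem b s = size s.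
Proof.
elim: s => [|x s IHs] /=; first by rewrite big1.
rewrite big_split /= IHs (bigD1 x) //= eqxx big1 ?addn0 // => b /negPf.
by rewrite eq_sym => ->.
Qed.

(** [wick s t] counts the bijections of positions that match [s] with [t], and each of the [n!]
    permutations of positions fits exactly one [t]. The induction removes the head of [t]. *)
Lemma sum_wick_tuple n s : size s = n -> \sum_(t : n.-tuple D) wick s t = n`!.
Proof.
elim: n s => [|n IHn] s sn.
  rewrite (bigD1 [tuple]) //= big1 ?addn0 => [|t]; last first.
    by rewrite [t]tuple0 => /eqP []; exact: val_inj.
  by rewrite (size0nil sn) /wick /= mul1n big1.
rewrite (reindex (fun p : D * n.-tuple D => [tuple of p.1 :: p.2])) /=; last first.
  exists (fun t : n.+1.-tuple D => (thead t, [tuple of behead t])) => [[b t] _|t _] /=.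
    by congr pair; apply: val_inj.
  by rewrite -tuple_eta.
rewrite -(pair_bigA _ (fun b (t : n.-tuple D) => wick s (b :: t))) /=.
transitivity (\sum_b count_mem b s * n`!)%N.
  apply: eq_bigr => b _; under eq_bigr do rewrite wick_cons.
  rewrite -big_distrr /=; have [bs|bs] := boolP (b \in s).
    by rewrite IHn // size_rem // sn.
  by rewrite (count_memPn bs).
by rewrite -big_distrl /= sum_count_mem sn factS.
Qed.

Lemma sum_wick n s : size s = n ->
  \sum_(x : {ffun 'I_n -> D}) wick s (codom x) = n`!.
Proof.
move=> /sum_wick_tuple <-.
rewrite (reindex (fun t : n.-tuple D => [ffun i => tnth t i])) /=; last first.
  exists (fun x : {ffun 'I_n -> D} => [tuple x i | i < n]) => [t _|x _].
    by apply: eq_from_tnth => i; rewrite tnth_mktuple ffunE.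
  by apply/ffunP => i; rewrite ffunE tnth_mktuple.
apply: eq_bigr => t _; congr wick.
rewrite -[RHS](map_tnth_enum t) codomE; by apply: eq_map => i; rewrite ffunE.
Qed.

Definition update n (y : {ffun 'I_n -> D}) k a : {ffun 'I_n -> D} :=
  [ffun j => if j == k then a else y j].

Lemma count_codom n (y : {ffun 'I_n -> D}) p :
  count p (codom y) = (\sum_(k < n) p (y k))%N.
Proof.
by rewrite codomE count_map -sum1_count big_enum_cond big_mkcond /=;
  apply: eq_bigr => k _; case: (p _).
Qed.

(** When the factor at site [k] has been contracted, the leftover letter [a] takes its place. *)
Lemma perm_update n (y : {ffun 'I_n -> D}) k a :
  perm_eq (rem (y k) (a :: codom y)) (codom (update y k a)).
Proof.
have yk : y k \in a :: codom y by rewrite inE codom_f orbT.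
rewrite -(perm_cons (y k)) -(permPl (perm_to_rem yk)).
apply/seq.permP => p /=; rewrite !count_codom (bigD1 k) // [in RHS](bigD1 k) //=.
rewrite ffunE eqxx addnCA; congr (_ + (_ + _))%N.
by apply: eq_bigr => j /negPf jk; rewrite ffunE jk.
Qed.

End Wick.

(** * Finite designs in several Gaussian variables *)

Section Design.
Variable C : numClosedFieldType.

Lemma prod_count (D : finType) (F : D -> C) s :
  \prod_(j <- s) F j = \prod_j F j ^+ count_mem j s.
Proof.
elim: s => [|x s IHs]; first by rewrite big_nil big1.
rewrite big_cons IHs /=; under [RHS]eq_bigr do rewrite exprD.
rewrite big_split /=; congr (_ * _).
rewrite (bigD1 x) //= eqxx big1 ?mulr1 // => j /negPf.
by rewrite eq_sym => ->.
Qed.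

(** One independent copy of the one-variable design per coordinate: moments factor over [D], and if
    [s] and [t] are not rearrangements of each other, some coordinate has unequal exponents and a
    zero factor. *)
Lemma gaussian_design (D : finType) N :
  exists (I : finType) (w : I -> C) (v : I -> D -> C),
  (forall i, 0 <= w i) /\
  forall s t : seq D, (size s <= N)%N -> (size t <= N)%N ->
    \sum_i w i * (\prod_(j <- s) v i j) * (\prod_(j <- t) v i j)^*
      = (wick s t)%:R.
Proof.
have [I [w [u [w_ge0 wu]]]] := gaussian_moments C N.
exists {ffun D -> I}, (fun f : {ffun D -> I} => \prod_j w (f j)),
  (fun (f : {ffun D -> I}) j => u (f j)).
split=> [f|s t sN tN]; first exact: prodr_ge0.
transitivity (\sum_(f : {ffun D -> I}) \prod_j (w (f j) * u (f j) ^+ count_mem j s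
    * (u (f j))^* ^+ count_mem j t)).
  apply: eq_bigr => f _; rewrite (prod_count _ s) (prod_count _ t) rmorph_prod /=.
  rewrite [RHS]big_split [X in _ = X * _]big_split /=; congr (_ * _).
  by apply: eq_bigr => j _; rewrite rmorphXn.
rewrite -(bigA_distr_bigA (fun j i => w i * u i ^+ count_mem j s
    * (u i)^* ^+ count_mem j t)).
under eq_bigr do rewrite wu ?(leq_trans (count_size _ _)) //.
rewrite -natr_prod big_split; congr (_ * _)%:R; rewrite /= /wick.
case: (boolP (perm_eq s t)) => [st|].
  by apply: big1 => j _; rewrite (seq.permP st) eqxx.
move=> st; suff [j jst] : exists j, count_mem j s != count_mem j t.
  by rewrite (bigD1 j) //= (negPf jst).
by move: st; rewrite /perm_eq => /allPn[j _ /= jst]; exists j.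
Qed.

End Design.

(** * Gaussian averages of symmetric functions *)

Section Core.
Variables (C : numClosedFieldType) (D : finType) (m : nat).
Local Notation sitesD := {ffun 'I_m -> D}.

Definition exchange_symmetric (f : sitesD -> C) :=
  forall (s : 'S_m) (x : sitesD), f [ffun k => x (s k)] = f x.

Lemma exchange_symmetric_perm f (x z : sitesD) :
  exchange_symmetric f -> perm_eq (codom z) (codom x) -> f x = f z.
Proof.
move=> fs zx; have ex (y : sitesD) : codom y = [tuple y i | i < m] by rewrite codomE.
have /tuple_permP[s es] : perm_eq [tuple z i | i < m] [tuple x i | i < m].
  by rewrite -!ex.
rewrite -(fs s x); congr f; apply/ffunP => k; rewrite ffunE.
have := congr1 (fun l => nth (z k) l k) es.
rewrite (_ : nth _ _ k = z k) => [->|]; last first.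
  by rewrite -tnth_nth tnth_mktuple.
by rewrite -tnth_nth !tnth_mktuple.
Qed.

(** Only the rearrangements [x] of [z] have nonzero weight, and [f] is constant on them; the total
    weight is [m!]. *)
Lemma sum_wick_symmetric f (z : sitesD) s :
  exchange_symmetric f -> perm_eq s (codom z) ->
  \sum_(x : sitesD) f x * (wick s (codom x))%:R = m`!%:R * f z.
Proof.
move=> fs sz; transitivity (\sum_(x : sitesD) f z * (wick s (codom x))%:R).
  apply: eq_bigr => x _; have [sx|] := boolP (perm_eq s (codom x)).
    by congr (_ * _); apply: exchange_symmetric_perm => //; rewrite -(permPl sz).
  by move=> /negPf sx; rewrite /wick sx !mulr0.
rewrite -mulr_sumr -natr_sum mulrC sum_wick // (perm_size sz) size_codom.
exact: card_ord.
Qed.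

(* v b ^* is contracted with v a or with one of the v (y k); what remains of
   the average acts on f as m! times the projection on symmetric functions. *)
Lemma gaussian_contraction : exists (I : finType) (w : I -> C) (v : I -> D -> C),
  (forall i, 0 <= w i) /\
  forall f g : sitesD -> C, exchange_symmetric f -> forall a b : D,
    \sum_i w i * (\sum_(x : sitesD) f x * (\prod_k v i (x k))^*)
        * (\sum_(y : sitesD) g y * (\prod_k v i (y k))^*)^* * v i a * (v i b)^* =
    m`!%:R * ((a == b)%:R * (\sum_(y : sitesD) f y * (g y)^*)
      + \sum_k \sum_(y : sitesD | y k == b) f (update y k a) * (g y)^*).
Proof.
(* Degree [m.+1]: the [m] sites and the additional letter [a] or [b]. *)
have [I [w [v [w_ge0 vE]]]] := gaussian_design C D m.+1.
exists I, w, v; split=> // f g fs a b.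
have vc i (x : sitesD) : \prod_k v i (x k) = \prod_(j <- codom x) v i j.
  by rewrite codomE big_map big_enum.
have size_c (x : sitesD) : size (codom x) = m by rewrite size_codom card_ord.
transitivity (\sum_(y : sitesD) (g y)^* * \sum_(x : sitesD) f x *
    (wick (a :: codom y) (b :: codom x))%:R).
  under [RHS]eq_bigr => y _ do under eq_bigr => x _ do
    rewrite -vE /= ?size_c // mulr_sumr.
  under [RHS]eq_bigr do rewrite exchange_big mulr_sumr /=.
  rewrite exchange_big; apply: eq_bigr => i _ /=.
  rewrite (rmorph_sum (@Num.conj C)) /= mulr_sumr mulr_sumr !mulr_suml.
  apply: eq_bigr => y _; rewrite !mulr_sumr !mulr_suml; apply: eq_bigr => x _.
  by rewrite !big_cons !rmorphM /= conjCK -!vc; ring.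
transitivity (\sum_(y : sitesD) (m`!%:R * ((a == b)%:R * (f y * (g y)^*))
    + \sum_k m`!%:R * ((y k == b)%:R * (f (update y k a) * (g y)^*)))).
  apply: eq_bigr => y _.
  (* [b] occurs in [a :: codom y] once if [a == b] and once for each site [k] with [y k == b]; every
     such contraction leaves the same word and contributes [R]. *)
  pose R := \sum_(x : sitesD) f x * (wick (rem b (a :: codom y)) (codom x))%:R.
  transitivity ((g y)^* * ((a == b)%:R * R + \sum_k (y k == b)%:R * R)).
    congr (_ * _); rewrite -mulr_suml -mulrDl -natr_sum -natrD mulr_sumr.
    apply: eq_bigr => x _; rewrite wick_cons natrM mulrCA; congr (_%:R * _).
    by rewrite /= count_codom.
  rewrite mulrDr; congr (_ + _).
    case: eqP => [ab|]; last by rewrite !(mul0r, mulr0).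
    rewrite !mul1r /R (sum_wick_symmetric (z := y)) //; first by ring.
    by rewrite ab /= eqxx perm_refl.
  rewrite mulr_sumr; apply: eq_bigr => k _.
  case: eqP => [yk|]; last by rewrite !(mul0r, mulr0).
  rewrite !mul1r /R (sum_wick_symmetric (z := update y k a)) //; first by ring.
  by rewrite -yk perm_update.
rewrite big_split exchange_big /= mulrDr !mulr_sumr; congr (_ + _).
apply: eq_bigr => k _; rewrite [in RHS]big_mkcond mulr_sumr; apply: eq_bigr => y _.
by case: eqP => _; rewrite ?mul1r // mul0r.
Qed.

(** Transposing [k] and [k0] in both functions shows that all sites contribute equally. *)
Lemma sum_update_site (f g : sitesD -> C) (k0 : 'I_m) a b :
  exchange_symmetric f -> exchange_symmetric g ->
  \sum_k \sum_(y : sitesD | y k == b) f (update y k a) * (g y)^* =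
  m%:R * \sum_(y : sitesD | y k0 == b) f (update y k0 a) * (g y)^*.
Proof.
move=> fs gs; set S := \sum_(y : sitesD | y k0 == b) _.
have -> : m%:R * S = \sum_(k < m) S by rewrite mulr_natl sumr_const card_ord.
apply: eq_bigr => k _; rewrite /S.
pose h (y : sitesD) : sitesD := [ffun j => y (tperm k k0 j)].
rewrite (reindex_inj (h := h)) /=; last first.
  by apply: can_inj (h) _ => y; apply/ffunP => j; rewrite !ffunE tpermK.
apply: eq_big => [y|y _]; first by rewrite ffunE tpermL.
rewrite gs -(fs (tperm k k0)); congr (f _ * _); apply/ffunP => j.
by rewrite !ffunE tpermK (can2_eq (tpermK k k0) (tpermK k k0)) tpermL.
Qed.
End Core.

(** * Channels in Kraus form *)

Section Kraus.
Variable R : realType.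
Local Notation C := R[i].

Lemma psd_conj n p (A : 'M[C]_n) (B : 'M[C]_(p, n)) :
  psd A -> psd (B *m A *m B ^t*).
Proof.
move=> A_ge0 v; have := A_ge0 (B ^t* *m v).
by rewrite trC_mul trmxCK !mulmxA.
Qed.

Lemma psd_sum n (I : finType) (w : I -> C) (A : I -> 'M[C]_n) :
  (forall k, 0 <= w k) -> (forall k, psd (A k)) -> psd (\sum_k w k *: A k).
Proof.
move=> w_ge0 A_ge0 v; rewrite mulmx_sumr mulmx_suml summxE sumr_ge0 // => k _.
by rewrite -scalemxAr -scalemxAl mxE mulr_ge0 // A_ge0.
Qed.

Lemma psd_mul_trC n p (B : 'M[C]_(n, p)) : psd (B *m B ^t*).
Proof.
rewrite -[B in B *m _]mulmx1; apply: psd_conj => v.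
rewrite mulmx1 mxE sumr_ge0 // => i _; rewrite mxE_trC mulrC; exact: mul_conjC_ge0.
Qed.

Lemma tens_trC m n p q (A : 'M[C]_(m, n)) (B : 'M[C]_(p, q)) :
  (tens A B) ^t* = tens (A ^t*) (B ^t*).
Proof. by rewrite mxtens.trmx_tens mxtens.map_mxT. Qed.

Lemma sum_delta_block n p (B : 'I_n -> 'I_n -> 'M[C]_p) i j a b :
  (\sum_i \sum_j tens (delta_mx i j : 'M[C]_n) (B i j))
    (tens_index (i, a)) (tens_index (j, b)) = B i j a b.
Proof.
rewrite summxE -[RHS](sum_delta _ (fun k => B k j a b)); apply: eq_bigr => k _.
rewrite summxE -[X in _ = _ * X](sum_delta _ (fun l => B k l a b)) mulr_sumr.
apply: eq_bigr => l _; rewrite mxtens.tensmxE !mxE mulrA -natrM mulnb.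
by rewrite (eq_sym i) (eq_sym j).
Qed.

Lemma choiE n p (T : 'M[C]_n -> 'M[C]_p) i j a b :
  choi T (tens_index (i, a)) (tens_index (j, b)) = T (delta_mx i j) a b.
Proof. exact: sum_delta_block. Qed.

Lemma matrix_tensP (T : Type) m n p q (A B : 'M[T]_(m * n, p * q)) :
  (forall i a j b, A (tens_index (i, a)) (tens_index (j, b)) =
                   B (tens_index (i, a)) (tens_index (j, b))) -> A = B.
Proof.
move=> eAB; apply/matrixP => x y.
by case: (mxtens.mxtens_indexP x) => i a; case: (mxtens.mxtens_indexP y) => j b.
Qed.

Lemma ampliation_conj k n p (A : 'M[C]_(p, n)) (X : 'M[C]_(k * n)) :
  ampliation (fun Y => A *m Y *m A ^t*) X =
  tens (1%:M : 'M[C]_k) A *m X *m (tens (1%:M : 'M[C]_k) A) ^t*.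
Proof.
have {2}-> : X = \sum_i \sum_j tens (delta_mx i j) (block X i j).
  by apply: matrix_tensP => i a j b; rewrite sum_delta_block mxE.
rewrite tens_trC mulmx_sumr mulmx_suml; apply: eq_bigr => i _.
rewrite mulmx_sumr mulmx_suml; apply: eq_bigr => j _.
by rewrite !mxtens.tensmx_mul trmx1 map_mx1 mul1mx mulmx1.
Qed.

Section KrausForm.
Variables (n p : nat) (I : finType) (w : I -> C) (A : I -> 'M[C]_(p, n)).
Variable T : 'M[C]_n -> 'M[C]_p.
Hypothesis TE : forall X, T X = \sum_k w k *: (A k *m X *m (A k) ^t*).

Lemma kraus_linear : linear T.
Proof.
move=> c X Y; rewrite !TE scaler_sumr -big_split; apply: eq_bigr => k _ /=.
rewrite mulmxDr mulmxDl scalerDr; congr (_ + _).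
by rewrite -scalemxAr -scalemxAl !scalerA mulrC.
Qed.

Hypothesis w_ge0 : forall k, 0 <= w k.

Lemma kraus_completely_positive : completely_positive T.
Proof.
move=> k X X_ge0.
suff -> : ampliation T X = \sum_l w l *: ampliation (fun Y => A l *m Y *m (A l) ^t*) X.
  by apply: psd_sum => // l; rewrite ampliation_conj; apply: psd_conj.
apply: matrix_tensP => i a j b; rewrite sum_delta_block TE !summxE.
by apply: eq_bigr => l _; rewrite mxE [RHS]mxE sum_delta_block.
Qed.

End KrausForm.

Lemma linear_delta_expand n p (T : 'M[C]_n -> 'M[C]_p) : linear T ->
  forall X, T X = \sum_i \sum_j X i j *: T (delta_mx i j).
Proof.
move=> linT X.
pose T' : {linear 'M[C]_n -> 'M[C]_p} :=
  HB.pack T (GRing.isLinear.Build _ _ _ _ T linT).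
rewrite -[T]/(T' : _ -> _) {1}[X]matrix_sum_delta linear_sum; apply: eq_bigr => i _.
by rewrite linear_sum; apply: eq_bigr => j _; rewrite linearZ.
Qed.

(** The Choi matrix is the ampliation of [T] at the positive operator [omega omega^*], where [omega]
    is the unnormalised maximally entangled vector. *)
Lemma psd_choi n p (T : 'M[C]_n -> 'M[C]_p) :
  completely_positive T -> psd (choi T).
Proof.
move=> cpT.
pose omega : 'cV[C]_(n * n) := \col_k
  ((mxtens.mxtens_unindex k).1 == (mxtens.mxtens_unindex k).2)%:R.
suff -> : choi T = ampliation T (omega *m omega ^t*).
  by apply: cpT; apply: psd_mul_trC.
rewrite /choi /ampliation; apply: eq_bigr => i _; apply: eq_bigr => j _.
congr (tens _ (T _)); apply/matrixP => a b.
rewrite !mxE big_ord1 !mxE !mxtens.mxtens_indexK /= conjC_nat -natrM mulnb.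
by rewrite (eq_sym a) (eq_sym b).
Qed.

(** The columns of a square root of the Choi matrix, reshaped into [p] by [n] matrices, are Kraus
    operators. *)
Lemma cp_kraus n p (T : 'M[C]_n -> 'M[C]_p) :
  linear T -> completely_positive T ->
  exists A : 'I_(n * p) -> 'M[C]_(p, n),
    forall X, T X = \sum_k A k *m X *m (A k) ^t*.
Proof.
move=> linT /psd_choi /nneg_form_sqrt[K eK _].
exists (fun k => \matrix_(a, i) K (tens_index (i, a)) k) => X.
apply/matrixP => a b; rewrite linear_delta_expand // !summxE.
under [LHS]eq_bigr do rewrite summxE.
under [LHS]eq_bigr => i _ do under eq_bigr => j _ do
  rewrite mxE -(choiE T) eK mxE mulr_sumr.
under [RHS]eq_bigr => k _ do rewrite mxE.
under [RHS]eq_bigr => k _ do under eq_bigr => i _ do rewrite mxE mulr_suml.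
under [LHS]eq_bigr do rewrite exchange_big.
rewrite exchange_big; apply: eq_bigr => k _; rewrite [RHS]exchange_big.
apply: eq_bigr => i _; apply: eq_bigr => j _ /=.
by rewrite !mxE; ring.
Qed.

Lemma channel_density n p (T : 'M[C]_n -> 'M[C]_p) rho :
  channel T -> density rho -> density (T rho).
Proof.
move=> [linT cpT tpT] [rho_ge0 rho1]; split; last by rewrite tpT.
have [A ->] := cp_kraus linT cpT.
under eq_bigr do rewrite -[_ *m _]scale1r.
by apply: psd_sum => k; rewrite ?ler01 //; apply: psd_conj.
Qed.

End Kraus.

(** * Separable Choi matrices as sums of rank-one terms *)

Section RankOne.
Variable R : realType.
Local Notation C := R[i].

(* That is, choi S = \sum_k w_k |r_k><r_k| (x) |s_k><s_k|. *)
Definition rank_one_form n p (I : finType) (w : I -> C) (r : I -> 'I_n -> C)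
    (s : I -> 'I_p -> C) (S : 'M[C]_n -> 'M[C]_p) :=
  forall i j a b, S (delta_mx i j) a b =
    \sum_k w k * (r k i * (r k j)^*) * (s k a * (s k b)^*).

Section RankOneForm.
Variables (n p : nat) (I : finType) (w : I -> C) (r : I -> 'I_n -> C).
Variables (s : I -> 'I_p -> C) (S : 'M[C]_n -> 'M[C]_p).
Hypotheses (linS : linear S) (w_ge0 : forall k, 0 <= w k).
Hypothesis SE : rank_one_form w r s S.

Lemma rank_oneE X a b : S X a b =
  \sum_k w k * (\sum_i \sum_j X i j * (r k i * (r k j)^*)) * (s k a * (s k b)^*).
Proof.
rewrite linear_delta_expand // summxE.
under eq_bigr => i _.
  rewrite summxE.
  under eq_bigr => j _ do rewrite mxE SE mulr_sumr.
  rewrite exchange_big.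
over.
rewrite exchange_big; apply: eq_bigr => k _ /=.
rewrite mulr_sumr mulr_suml; apply: eq_bigr => i _.
rewrite mulr_sumr mulr_suml; apply: eq_bigr => j _; ring.
Qed.

(** Each term has a single Kraus operator, of rank at most one, with entries [s k a * r k i]. *)
Lemma rank_one_completely_positive : completely_positive S.
Proof.
pose A k : 'M[C]_(p, n) := \matrix_(a, i) (s k a * r k i).
apply: (@kraus_completely_positive _ _ _ I w A) => // X; rewrite /A.
apply/matrixP => a b; rewrite rank_oneE summxE; apply: eq_bigr => k _.
rewrite mxE -mulrA; congr (_ * _); rewrite mxE mulr_suml.
under [RHS]eq_bigr do rewrite mxE mulr_suml.
rewrite [RHS]exchange_big; apply: eq_bigr => i _; rewrite mulr_suml.
apply: eq_bigr => j _; rewrite !mxE rmorphM /=; ring.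
Qed.

Let sqnorm q (v : 'I_q -> C) := \sum_i v i * (v i)^*.

Lemma sqnorm_ge0 q (v : 'I_q -> C) : 0 <= sqnorm v.
Proof. by apply: sumr_ge0 => i _; apply: mul_conjC_ge0. Qed.

Lemma sqnorm_eq0 q (v : 'I_q -> C) : sqnorm v = 0 -> forall i, v i = 0.
Proof.
move=> /eqP; rewrite psumr_eq0 => [/allP v0 i|i _]; last exact: mul_conjC_ge0.
by have := v0 i (mem_index_enum _); rewrite mul_conjC_eq0 => /eqP.
Qed.

Lemma normalized_density q (v : 'I_q -> C) : sqnorm v != 0 ->
  density ((sqnorm v)^-1 *: \matrix_(i, j) (v i * (v j)^*)).
Proof.
move=> v0; split.
  have -> : (sqnorm v)^-1 *: \matrix_(i, j) (v i * (v j)^*) =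
    \sum_(k < 1) (sqnorm v)^-1 *: ((\col_i v i) *m (\col_i v i) ^t*).
    rewrite big_ord1; congr (_ *: _); apply/matrixP => i j.
    by rewrite !mxE big_ord1 !mxE.
  by apply: psd_sum => _; [rewrite invr_ge0 sqnorm_ge0 | apply: psd_mul_trC].
rewrite mxtraceZ (_ : \tr _ = sqnorm v) ?mulVf //.
by apply: eq_bigr => i _; rewrite mxE.
Qed.

Lemma rank_one_separable : separable (choi S).
Proof.
(* Null vectors cannot be normalised: their terms are discarded. *)
pose P := [pred k | (sqnorm (r k) != 0) && (sqnorm (s k) != 0)].
exists #|P|,
  (fun l => w (enum_val l) * sqnorm (r (enum_val l)) * sqnorm (s (enum_val l))).
exists (fun l => (sqnorm (r (enum_val l)))^-1 *:
  \matrix_(i, j) (r (enum_val l) i * (r (enum_val l) j)^*)).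
exists (fun l => (sqnorm (s (enum_val l)))^-1 *:
  \matrix_(i, j) (s (enum_val l) i * (s (enum_val l) j)^*)).
have Pl (l : 'I_#|P|) := enum_valP l.
split=> [l|l|l|]; first by rewrite !mulr_ge0 ?sqnorm_ge0.
- by apply: normalized_density; have /andP[] := Pl l.
- by apply: normalized_density; have /andP[] := Pl l.
apply: matrix_tensP => i a j b; rewrite choiE SE summxE.
rewrite (bigID (mem P)) /= [X in _ + X]big1 => [|k]; last first.
  rewrite negb_and !negbK => /orP[]/eqP/sqnorm_eq0 -> ; by rewrite ?(mul0r, mulr0).
rewrite addr0 (@big_enum_val _ _ _ I P
  (fun k => w k * (r k i * (r k j)^*) * (s k a * (s k b)^*))).
apply: eq_bigr => l _; rewrite mxE mxtens.tensmxE !mxE.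
have /andP[r0 s0] := Pl l; field; by rewrite r0 s0.
Qed.

End RankOneForm.

(** Both factors of every product term are diagonalised, so an index consists of a term and an
    eigenvector of each factor. The unit norm of [s] lets it be prepared as a pure state at every
    site. *)
Lemma separable_rank_one n p (S : 'M[C]_n -> 'M[C]_p) : separable (choi S) ->
  exists (I : finType) (w : I -> C) (r : I -> 'I_n -> C) (s : I -> 'I_p -> C),
  [/\ forall k, 0 <= w k, forall k, \sum_a s k a * (s k a)^* = 1 &
      rank_one_form w r s S].
Proof.
move=> [N [w [rho [sigma [w_ge0 rhoD sigmaD eS]]]]].
have spectral q (A : 'I_N -> 'M[C]_q) : (forall k, density (A k)) ->
  exists Ql : 'I_N -> 'M[C]_q * 'rV[C]_q, forall k,
   [/\ (Ql k).1 *m (Ql k).1 ^t* = 1%:M, forall i, 0 <= (Ql k).2 0 i &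
    A k = (Ql k).1 ^t* *m diag_mx (Ql k).2 *m (Ql k).1].
  move=> AD; have ex k : exists Ql : 'M[C]_q * 'rV[C]_q,
     [/\ Ql.1 *m Ql.1 ^t* = 1%:M, forall i, 0 <= Ql.2 0 i &
      A k = Ql.1 ^t* *m diag_mx Ql.2 *m Ql.1].
    have [QQ _ l_ge0 eA] := nneg_form_spectral (AD k).1.
    by exists (spectralmx (A k), spectral_diag (A k)).
  by have [f fP] := choice ex; exists f.
have [rs rsP] := spectral _ _ rhoD; have [ss ssP] := spectral _ _ sigmaD.
(* By this expansion the eigenvectors are the conjugated rows of [Q]. *)
have entry q (Q : 'M[C]_q) l i j :
   (Q ^t* *m diag_mx l *m Q) i j = \sum_e l 0 e * ((Q e i)^* * Q e j).
  rewrite mxE; apply: eq_bigr => e _; rewrite mul_mx_diag !mxE; ring.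
exists ('I_N * ('I_n * 'I_p))%type,
  (fun k => w k.1 * (rs k.1).2 0 k.2.1 * (ss k.1).2 0 k.2.2),
  (fun k i => ((rs k.1).1 k.2.1 i)^*), (fun k a => ((ss k.1).1 k.2.2 a)^*).
split=> [[k [e f]]|[k [e f]]|i j a b] /=.
- have [_ ? _] := rsP k; have [_ ? _] := ssP k; by rewrite !mulr_ge0.
- have [/matrixP/(_ f f) QQ _ _] := ssP k; move: QQ.
  rewrite mxE [RHS]mxE eqxx => QQ; rewrite -[RHS]/(true%:R) -QQ.
  by apply: eq_bigr => a _; rewrite mxE_trC conjCK mulrC.
rewrite -choiE eS summxE.
rewrite -(pair_bigA _ (fun k ef => w k * (rs k).2 0 ef.1 * (ss k).2 0 ef.2 *
  (((rs k).1 ef.1 i)^* * ((rs k).1 ef.1 j)^*^*) *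
  (((ss k).1 ef.2 a)^* * ((ss k).1 ef.2 b)^*^*))) /=.
apply: eq_bigr => k _; rewrite mxE mxtens.tensmxE.
have [_ _ ->] := rsP k; have [_ _ ->] := ssP k; rewrite !entry.
rewrite -(pair_bigA _ (fun e f => w k * (rs k).2 0 e * (ss k).2 0 f *
  (((rs k).1 e i)^* * ((rs k).1 e j)^*^*) *
  (((ss k).1 f a)^* * ((ss k).1 f b)^*^*))) /=.
rewrite mulr_suml mulr_sumr; apply: eq_bigr => e _.
rewrite !mulr_sumr; apply: eq_bigr => f _; rewrite !conjCK; ring.
Qed.

End RankOne.

(** * Marginals and symmetries of multipartite outputs *)

Section RelabelMatrix.
Variables (C : numClosedFieldType) (n : nat) (g : 'I_n -> 'I_n).

Definition relabel_mx : 'M[C]_n := \matrix_(x, y) (g x == y)%:R.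

Lemma relabel_mulmx p (M : 'M[C]_(n, p)) x y : (relabel_mx *m M) x y = M (g x) y.
Proof.
rewrite mxE -[RHS](sum_delta _ (fun z => M z y)); apply: eq_bigr => z _.
by rewrite mxE eq_sym.
Qed.

Lemma relabel_conj (M : 'M[C]_n) x y :
  (relabel_mx *m M *m relabel_mx ^t*) x y = M (g x) (g y).
Proof.
have -> : relabel_mx *m M *m relabel_mx ^t* = (relabel_mx *m (relabel_mx *m M) ^t*) ^t*.
  by rewrite trC_mul trmxCK.
by rewrite mxE_trC relabel_mulmx mxE_trC conjCK relabel_mulmx.
Qed.

Lemma relabel_unitary : injective g -> relabel_mx ^t* *m relabel_mx = 1%:M.
Proof.
move=> g_inj; apply: mulmx1C; apply/matrixP => x y.
by rewrite relabel_mulmx mxE_trC !mxE conjC_nat (inj_eq g_inj) eq_sym.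
Qed.

End RelabelMatrix.

Section Multipartite.
Variables (R : realType) (m d : nat).
Local Notation C := R[i].
Local Notation sitesd := {ffun 'I_m -> 'I_d}.

Definition site_shift (s : 'S_m) (x : 'I_(tdim m d)) : 'I_(tdim m d) :=
  enum_rank ([ffun k => (enum_val x : sitesd) (s k)] : sitesd).

Lemma site_shift_inj s : injective (site_shift s).
Proof.
move=> x y /enum_rank_inj /ffunP e; apply: enum_val_inj; apply/ffunP => k.
by have := e (s^-1 k)%g; rewrite !ffunE permKV.
Qed.

Lemma site_shift_rank s (x : sitesd) :
  site_shift s (enum_rank x) = enum_rank ([ffun k => x (s k)] : sitesd).
Proof. by rewrite /site_shift enum_rankK. Qed.

Lemma site_permE s : @site_perm R m d s = relabel_mx C (site_shift s).
Proof.
apply/matrixP => x y; rewrite !mxE /site_shift -(inj_eq enum_val_inj).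
by rewrite enum_rankK.
Qed.

Definition output_shift n s (x : 'I_(n * tdim m d)) : 'I_(n * tdim m d) :=
  let ix := mxtens.mxtens_unindex x in tens_index (ix.1, site_shift s ix.2).

Lemma output_shiftE n s i x :
  @output_shift n s (tens_index (i, x)) = tens_index (i, site_shift s x).
Proof. by rewrite /output_shift mxtens.mxtens_indexK. Qed.

Lemma output_shift_inj n s : injective (@output_shift n s).
Proof.
move=> x y; case: (mxtens.mxtens_indexP x) => i a.
case: (mxtens.mxtens_indexP y) => j b; rewrite !output_shiftE.
by move/(can_inj (@mxtens.mxtens_indexK _ _)) => [-> /site_shift_inj ->].
Qed.

Lemma tens_site_permE n s :
  tens (1%:M : 'M[C]_n) (site_perm R d s) = relabel_mx C (@output_shift n s).
Proof.
apply: matrix_tensP => i a j b; rewrite mxtens.tensmxE site_permE !mxE output_shiftE.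
by rewrite (inj_eq (can_inj (@mxtens.mxtens_indexK _ _))) xpair_eqE -natrM mulnb.
Qed.

Lemma exchange_invariantP n (T : 'M[C]_n -> 'M[C]_(tdim m d)) :
  exchange_invariant T <->
  forall s i j x y, T (delta_mx i j) (site_shift s x) (site_shift s y) =
    T (delta_mx i j) x y.
Proof.
split=> [Tinv s i j x y|Tinv s /=].
  have := Tinv s; rewrite /= tens_site_permE => /matrixP.
  move=> /(_ (tens_index (i, x)) (tens_index (j, y))).
  by rewrite relabel_conj !output_shiftE !choiE.
rewrite tens_site_permE; apply: matrix_tensP => i x j y.
by rewrite relabel_conj !output_shiftE !choiE.
Qed.

Lemma set_siteK (x : sitesd) k a b : set_site (set_site x k a) k b = set_site x k b.
Proof. by apply/ffunP => j; rewrite !ffunE; case: eqP. Qed.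

Lemma set_site_id (x : sitesd) k : set_site x k (x k) = x.
Proof. by apply/ffunP => j; rewrite !ffunE; case: eqP => // ->. Qed.

Lemma set_site_at (x : sitesd) k a : set_site x k a k = a.
Proof. by rewrite ffunE eqxx. Qed.

Lemma reindex_set_site k a b (F : sitesd -> C) :
  \sum_(x : sitesd | x k == a) F x = \sum_(x : sitesd | x k == b) F (set_site x k a).
Proof.
rewrite (reindex_onto (fun x => set_site x k a) (fun x => set_site x k b)) /=; last first.
  by move=> x /eqP <-; rewrite set_siteK set_site_id.
apply: eq_bigl => x; rewrite set_site_at eqxx set_siteK.
apply/eqP/eqP => [<-|<-]; first by rewrite set_site_at.
exact: set_site_id.
Qed.

Lemma marginalE k (M : 'M[C]_(tdim m d)) a b : marginal k M a b =
  \sum_(x : sitesd | x k == b) M (enum_rank (set_site x k a)) (enum_rank x).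
Proof.
rewrite mxE (reindex_set_site _ _ b); apply: eq_bigr => x /eqP <-.
by rewrite set_siteK set_site_id.
Qed.

Lemma sum_sites (F : 'I_(tdim m d) -> C) :
  \sum_z F z = \sum_(x : sitesd) F (enum_rank x).
Proof.
rewrite (reindex enum_rank) //.
by exists enum_val => x _; rewrite ?enum_rankK ?enum_valK.
Qed.

Lemma mxtrace_marginal k (M : 'M[C]_(tdim m d)) : \tr (marginal k M) = \tr M.
Proof.
rewrite /mxtrace sum_sites (partition_big (fun x : sitesd => x k) xpredT) //=.
apply: eq_bigr => a _; rewrite marginalE; apply: eq_bigr => x /eqP <-.
by rewrite set_site_id.
Qed.

(* z also ranges over the values of the site k, which is not traced out: hence
   the weight 1/d. *)
Lemma marginal_kraus k (M : 'M[C]_(tdim m d)) :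
  marginal k M = \sum_(z : sitesd) d%:R^-1 *:
    ((\matrix_(a, x) (enum_rank (set_site z k a) == x)%:R) *m M *m
     (\matrix_(a, x) (enum_rank (set_site z k a) == x)%:R) ^t*).
Proof.
apply/matrixP => a b; rewrite summxE.
pose F z := M (enum_rank (set_site z k a)) (enum_rank (set_site z k b)).
have -> : marginal k M a b = \sum_(x : sitesd | x k == a) F x.
  rewrite mxE; apply: eq_bigr => x /eqP xa; rewrite /F.
  by have -> : set_site x k a = x by rewrite -xa set_site_id.
transitivity (\sum_z d%:R^-1 * F z).
  (* Each of the [d] values at the site [k] gives the same sum; [d] is nonzero because [a] belongs
     to ['I_d]. *)
  set S := (X in X = _); have -> : S = d%:R^-1 * \sum_(c < d) S.
    rewrite sumr_const card_ord -[S *+ d]mulr_natl mulKf // pnatr_eq0 -lt0n.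
    exact: leq_ltn_trans (ltn_ord a).
  rewrite -mulr_sumr [in RHS](partition_big (fun x : sitesd => x k) xpredT) //=.
  congr (_ * _); apply: eq_bigr => c _; rewrite (reindex_set_site _ c a).
  by apply: eq_bigr => x _; rewrite /F !set_siteK.
apply: eq_bigr => z _; rewrite mxE; congr (_ * _).
set B := \matrix_(_, _) _.
have BE c y : B c y = (y == enum_rank (set_site z k c))%:R by rewrite mxE eq_sym.
rewrite mxE -[LHS](sum_delta _ (fun y => M (enum_rank (set_site z k a)) y)).
apply: eq_bigr => y _; rewrite mxE_trC BE conjC_nat mulrC; congr (_ * _).
rewrite mxE -[LHS](sum_delta _ (fun x => M x y)).
by apply: eq_bigr => x _; rewrite BE.
Qed.

Lemma marginal_channel n k (T : 'M[C]_n -> 'M[C]_(tdim m d)) :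
  channel T -> channel (fun X => marginal k (T X)).
Proof.
move=> [linT cpT tpT]; have [A AE] := cp_kraus linT cpT.
pose B (z : sitesd) : 'M[C]_(d, tdim m d) :=
  \matrix_(a, x) (enum_rank (set_site z k a) == x)%:R.
have TE X : marginal k (T X) = \sum_(ze : sitesd * 'I_(n * tdim m d))
    d%:R^-1 *: ((B ze.1 *m A ze.2) *m X *m (B ze.1 *m A ze.2) ^t*).
  rewrite marginal_kraus -(pair_bigA _ (fun z e =>
    d%:R^-1 *: ((B z *m A e) *m X *m (B z *m A e) ^t*))) /=.
  apply: eq_bigr => z _; rewrite -scaler_sumr AE mulmx_sumr mulmx_suml.
  by congr (_ *: _); apply: eq_bigr => e _; rewrite trC_mul !mulmxA.
split; first exact: kraus_linear TE.
  by apply: kraus_completely_positive TE _ => _; rewrite invr_ge0 ler0n.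
by move=> X; rewrite mxtrace_marginal tpT.
Qed.

End Multipartite.

(** * Protocols preparing product states *)

Section ProductProtocol.
Variables (R : realType) (n m d : nat).
Local Notation C := R[i].
Local Notation sitesd := {ffun 'I_m -> 'I_d}.

Lemma eb_channel_product_protocol (S : 'M[C]_n -> 'M[C]_d) sym :
  eb_channel S -> exists2 T : 'M[C]_n -> 'M[C]_(tdim m d),
    protocol sym T & forall k X, marginal k (T X) = S X.
Proof.
move=> [[linS _ tpS] /separable_rank_one[I [w [r [s [w_ge0 s1 SE]]]]]].
(* The product vector with [s k] at every site; [T] keeps the weights and the measurement vectors of
   [S]. *)
pose ps k (x : 'I_(tdim m d)) := \prod_l s k ((enum_val x : sitesd) l).
pose T (X : 'M[C]_n) : 'M[C]_(tdim m d) := \matrix_(x, y) \sum_k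
  w k * (\sum_i \sum_j X i j * (r k i * (r k j)^*)) * (ps k x * (ps k y)^*).
have linT : linear T.
  move=> c X Y; apply/matrixP => x y; rewrite !mxE mulr_sumr -big_split.
  apply: eq_bigr => k _ /=; 
  have -> : \sum_i \sum_j (c *: X + Y) i j * (r k i * (r k j)^*) =
      c * (\sum_i \sum_j X i j * (r k i * (r k j)^*)) +
      \sum_i \sum_j Y i j * (r k i * (r k j)^*).
    rewrite mulr_sumr -big_split; apply: eq_bigr => i _ /=.
    rewrite mulr_sumr -big_split; apply: eq_bigr => j _ /=.
    by rewrite !mxE; ring.
  by ring.
have TE : rank_one_form w r ps T.
  move=> i j x y; rewrite mxE; apply: eq_bigr => k _; congr (_ * _ * _).
  rewrite -[RHS](sum_delta i (fun i => r k i * (r k j)^*)); apply: eq_bigr => i' _.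
  rewrite -[X in _ = _ * X](sum_delta j (fun j => r k i' * (r k j)^*)) mulr_sumr.
  by apply: eq_bigr => j' _; rewrite mxE [RHS]mulrA -natrM mulnb.
have psum k : \sum_x ps k x * (ps k x)^* = 1.
  rewrite sum_sites; transitivity (\sum_(x : sitesd) \prod_l (s k (x l) * (s k (x l))^*)).
    by apply: eq_bigr => x _; rewrite /ps enum_rankK rmorph_prod -big_split.
  rewrite -(bigA_distr_bigA (fun _ b => s k b * (s k b)^*)) big1 // => l _.
have margT k X : marginal k (T X) = S X.
  apply/matrixP => a b; rewrite (rank_oneE linS SE) marginalE.
  under eq_bigr do rewrite mxE.
  rewrite exchange_big; apply: eq_bigr => e _ /=; rewrite -mulr_sumr; congr (_ * _).
  have psE (x : sitesd) c : ps e (enum_rank (set_site x k c)) =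
      s e c * \prod_(l | l != k) s e (x l).
    rewrite /ps enum_rankK (bigD1 k) //= set_site_at; congr (_ * _).
    by apply: eq_bigr => l /negPf lk; rewrite ffunE lk.
  transitivity (s e a * (s e b)^* *
     \sum_(x : sitesd | x k == b) \prod_(l | l != k) (s e (x l) * (s e (x l))^*)).
    rewrite mulr_sumr; apply: eq_bigr => x /eqP xk.
    rewrite -[x in X in _ * X^*](set_site_id x k) !psE xk rmorphM rmorph_prod.
    by rewrite big_split /=; ring.
  rewrite -[RHS]mulr1; congr (_ * _).
  (* The constraint [x k == b] becomes a factor at site [k], so the sum over configurations is a
     product over sites of sums equal to 1. *)
  pose G l c : C := if l == k then (c == b)%:R else s e c * (s e c)^*.
  transitivity (\sum_(x : sitesd) \prod_l G l (x l)).
    rewrite big_mkcond; apply: eq_bigr => x _; rewrite [in RHS](bigD1 k) //= {1}/G eqxx.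
    case: eqP => _; rewrite ?mul0r ?mul1r //.
    by apply: eq_bigr => l /negPf lk; rewrite /G lk.
  rewrite -(bigA_distr_bigA G) big1 // => l _; rewrite /G.
  case: eqP => _; last exact: s1.
  by under eq_bigr do rewrite -[_%:R]mulr1; rewrite (sum_delta b (fun=> 1)).
have psS k (p : 'S_m) x : ps k (site_shift p x) = ps k x.
  rewrite /ps /site_shift enum_rankK [in RHS](reindex_inj (@perm_inj _ p)).
  by apply: eq_bigr => l _; rewrite ffunE.
(* Invariance in the row index alone puts the columns of [T X] in the symmetric subspace. *)
have TS (p : 'S_m) X x y : T X (site_shift p x) y = T X x y.
  by rewrite !mxE; apply: eq_bigr => k _; rewrite psS.
exists T => //; split.
  split=> //; first exact: rank_one_completely_positive linT w_ge0 TE.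
  (* The prepared vectors have norm one, so the traces of [T X] and [S X] agree term by term, and
     [S] preserves the trace. *)
  move=> X; rewrite -tpS /mxtrace.
  under eq_bigr do rewrite (rank_oneE linT TE).
  under [RHS]eq_bigr do rewrite (rank_oneE linS SE).
  rewrite exchange_big [RHS]exchange_big; apply: eq_bigr => k _ /=.
  by rewrite -!mulr_sumr psum s1.
case: sym.
  apply/exchange_invariantP => p i j x y.
  by rewrite !TE; under eq_bigr do rewrite !psS.
move=> rho _ v p; rewrite site_permE; apply/matrixP => x y.
by rewrite relabel_mulmx !mxE; apply: eq_bigr => z _; rewrite TS.
Qed.

End ProductProtocol.

Lemma sum_tens_index (V : nmodType) n p (G : 'I_(n * p) -> V) :
  \sum_z G z = \sum_i \sum_a G (tens_index (i, a)).
Proof.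
rewrite pair_bigA (reindex (@mxtens.mxtens_index n p)) /=; last first.
  exists (@mxtens.mxtens_unindex n p) => z _; first exact: mxtens.mxtens_indexK.
  exact: mxtens.mxtens_unindexK.
by apply: eq_bigr => -[i a].
Qed.

(** * Dilations to symmetric outputs *)

Section Dilation.
Variables (R : realType) (n m d : nat).
Local Notation C := R[i].
Local Notation sitesd := {ffun 'I_m -> 'I_d}.

(* The output of T is the partial trace over the spaces C^F of a completely
   positive map whose outputs are supported on the symmetric subspace of
   (C^d (x) C^F)^{(x) m}; e is a Kraus index. *)
Definition symmetric_dilation (F E : finType)
    (K : E -> 'I_n -> sitesd -> {ffun 'I_m -> F} -> C)
    (T : 'M[C]_n -> 'M[C]_(tdim m d)) :=
  (forall (p : 'S_m) e i (x : sitesd) (u : {ffun 'I_m -> F}),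
     K e i [ffun k => x (p k)] [ffun k => u (p k)] = K e i x u) /\
  forall i j x y, T (delta_mx i j) (enum_rank x) (enum_rank y) =
    \sum_e \sum_u K e i x u * (K e j y u)^*.

(** Exchange invariance means that the Choi matrix commutes with the site permutations; hence so
    does its square root [K], which is then fixed when its rows and columns are permuted together.
    The column index of [K] supplies both the Kraus index and a second copy of the [m] sites, so
    that [F] is ['I_d]. *)
Lemma exchange_invariant_dilation (T : 'M[C]_n -> 'M[C]_(tdim m d)) :
  completely_positive T -> exchange_invariant T ->
  exists K : 'I_n -> 'I_n -> sitesd -> sitesd -> C, symmetric_dilation K T.
Proof.
move=> /psd_choi /nneg_form_sqrt[K eK comK] Tinv.
exists (fun e i x u => K (tens_index (i, enum_rank x)) (tens_index (e, enum_rank u))).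
split=> [p e i x u|i j x y].
  set U := relabel_mx C (@output_shift m d n p).
  have UU : U ^t* *m U = 1%:M by apply: relabel_unitary; apply: output_shift_inj.
  have UU' := mulmx1C UU.
  have UC : U *m choi T = choi T *m U.
    have := Tinv p; rewrite /= tens_site_permE -/U => {2}<-.
    by rewrite -!mulmxA UU mulmx1.
  rewrite -!site_shift_rank -!output_shiftE -relabel_conj -/U (comK _ UC).
  by rewrite -mulmxA UU' mulmx1.
rewrite -choiE eK mxE sum_tens_index.
apply: eq_bigr => e _; rewrite sum_sites; apply: eq_bigr => u _.
by rewrite mxE_trC.
Qed.

(** The trivial [F = unit] suffices, because the rows of a square root of the Choi matrix inherit
    the symmetry of the outputs. *)
Lemma bosonic_dilation (T : 'M[C]_n -> 'M[C]_(tdim m d)) :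
  completely_positive T -> bosonic T ->
  exists K : 'I_(n * tdim m d) -> 'I_n -> sitesd -> {ffun 'I_m -> unit} -> C,
    symmetric_dilation K T.
Proof.
move=> /psd_choi Cpsd Tbos; have CH := quad_form_ge0_herm Cpsd.
have [K eK _] := nneg_form_sqrt Cpsd.
exists (fun e i x u => K (tens_index (i, enum_rank x)) e).
have entry i j x y : T (delta_mx i j) x y =
    \sum_e K (tens_index (i, x)) e * (K (tens_index (j, y)) e)^*.
  by rewrite -choiE eK mxE; apply: eq_bigr => e _; rewrite mxE_trC.
split=> [p e i x u|i j x y]; last first.
  rewrite entry; apply: eq_bigr => e _.
  by rewrite sumr_const [X in _ *+ X](_ : _ = 1%N) // card_ffun card_unit exp1n.
(* The bosonic condition concerns density operators, so it is applied to the diagonal matrix units;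
   the corresponding blocks of the Choi matrix are Gram matrices of rows of [K]. *)
have Ei : density (delta_mx i i : 'M[C]_n).
  split.
    rewrite -[delta_mx i i](mul_delta_mx (0 : 'I_1)).
    have -> : delta_mx 0 i = (delta_mx i 0 : 'cV[C]_n) ^t*.
      by apply/matrixP => a b; rewrite !mxE conjC_nat andbC.
    exact: psd_mul_trC.
  rewrite /mxtrace -[RHS](sum_delta i (fun=> 1)); apply: eq_bigr => k _.
  by rewrite mxE andbb mulr1.
have Tp y z : T (delta_mx i i) (site_shift p y) z = T (delta_mx i i) y z.
  have := Tbos _ Ei (delta_mx z 0) p; rewrite site_permE -colE.
  by move=> /matrixP/(_ y 0); rewrite relabel_mulmx !mxE.
have TH y z : T (delta_mx i i) y z = (T (delta_mx i i) z y)^*.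
  by rewrite -!choiE -mxE_trC CH.
set y := enum_rank x; rewrite -site_shift_rank -/y.
apply/eqP; rewrite -subr_eq0 -mul_conjC_eq0; apply/eqP.
(* f is a difference of two rows of K; its squared norm is a combination of
   entries of the i-th diagonal block of choi T, which cancels by symmetry. *)
pose f e' := K (tens_index (i, site_shift p y)) e' - K (tens_index (i, y)) e'.
have : \sum_e' f e' * (f e')^* = 0.
  transitivity (T (delta_mx i i) (site_shift p y) (site_shift p y)
    - T (delta_mx i i) (site_shift p y) y - T (delta_mx i i) y (site_shift p y)
    + T (delta_mx i i) y y).
    rewrite !entry -!sumrB -big_split; apply: eq_bigr => e' _ /=.
    by rewrite /f rmorphB; ring.
  rewrite Tp Tp [T _ y (site_shift p y)]TH Tp -TH; ring.
move/eqP; rewrite psumr_eq0 => [/allP f0|e' _]; last exact: mul_conjC_ge0.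
exact/eqP/f0/mem_index_enum.
Qed.

End Dilation.

(** * Measure-and-prepare approximation *)

Section Approximant.
Variables (R : realType) (n m d : nat) (i0 : 'I_m).
Local Notation C := R[i].
Local Notation sitesd := {ffun 'I_m -> 'I_d}.
Variables (F E : finType) (K : E -> 'I_n -> sitesd -> {ffun 'I_m -> F} -> C).
Variable T : 'M[C]_n -> 'M[C]_(tdim m d).
Hypotheses (Tch : channel T) (KT : symmetric_dilation K T).

(* The measure-and-prepare channel built from the Gaussian design on C^d (x) C^F,
   in the closed form given by gaussian_contraction. *)
Definition eb_approximant (X : 'M[C]_n) : 'M[C]_d :=
  (m + d * #|F|)%:R^-1 *: ((#|F|%:R * \tr X)%:M + m%:R *: marginal i0 (T X)).

Let D : finType := ('I_d * F)%type.
Let p1 (z : {ffun 'I_m -> D}) : sitesd := [ffun k => (z k).1].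
Let p2 (z : {ffun 'I_m -> D}) : {ffun 'I_m -> F} := [ffun k => (z k).2].

Lemma sum_pair_sites (G : sitesd -> {ffun 'I_m -> F} -> C) :
  \sum_(z : {ffun 'I_m -> D}) G (p1 z) (p2 z) = \sum_x \sum_u G x u.
Proof.
rewrite pair_bigA [LHS](reindex (fun xu : sitesd * {ffun 'I_m -> F} =>
   [ffun k => (xu.1 k, xu.2 k)] : {ffun 'I_m -> D})) /=; last first.
  exists (fun z => (p1 z, p2 z)) => [[x u] _|z _] /=.
    by congr pair; apply/ffunP => k; rewrite !ffunE.
  by apply/ffunP => k; rewrite !ffunE; case: (z k).
apply: eq_bigr => -[x u] _ /=.
by congr G; apply/ffunP => k; rewrite !ffunE.
Qed.

Lemma eb_approximantE X a b : eb_approximant X a b = (m + d * #|F|)%:R^-1 *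
  (#|F|%:R * \tr X *+ (a == b) + m%:R * marginal i0 (T X) a b).
Proof. by rewrite mxE mxE mxE [X in _ + X]mxE. Qed.

Lemma eb_approximant_linear : linear eb_approximant.
Proof.
have [linM _ _] := marginal_channel i0 Tch.
move=> c X Y; apply/matrixP => a b.
have trE : \tr (c *: X + Y) = c * \tr X + \tr Y by rewrite mxtraceD mxtraceZ.
have margE : marginal i0 (T (c *: X + Y)) a b =
    c * marginal i0 (T X) a b + marginal i0 (T Y) a b.
  by rewrite linM; move: (marginal _ _) (marginal _ _) => M M'; rewrite !mxE.
transitivity (c * eb_approximant X a b + eb_approximant Y a b); last first.
  by move: (eb_approximant _) (eb_approximant _) => M M'; rewrite !mxE.
rewrite [LHS]eb_approximantE trE margE [eb_approximant X a b]eb_approximantE.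
rewrite [eb_approximant Y a b]eb_approximantE.
by rewrite !mulrb; case: ifP => _; ring.
Qed.

(** An outcome consists of a Kraus index, a design point and a basis vector of the traced-out [C^F].
    In the Gaussian contraction the term with [a == b] yields the trace of [X], and the sum over
    sites yields [m] times the marginal. *)
Lemma eb_approximant_eb_channel : eb_channel eb_approximant.
Proof.
have [linM _ tpM] := marginal_channel i0 Tch.
have linS := eb_approximant_linear.
have m0 : m%:R != 0 :> C by rewrite pnatr_eq0 -lt0n (leq_ltn_trans _ (ltn_ord i0)).
have N0 : (m + d * #|F|)%:R != 0 :> C.
  by rewrite pnatr_eq0 -lt0n addn_gt0 (leq_ltn_trans _ (ltn_ord i0)).
have [I [w [v [w_ge0 contraction]]]] := gaussian_contraction C D m.
pose f e i (z : {ffun 'I_m -> D}) := K e i (p1 z) (p2 z).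
have fs e i : exchange_symmetric (f e i).
  move=> p z; rewrite /f -[RHS](KT.1 p); congr K; apply/ffunP => k; rewrite !ffunE //.
(* The weight cancels the [m!] of the contraction and normalises the trace, which is otherwise
   multiplied by [m + d * #|F|]. *)
pose W (eif : E * (I * F)) := ((m`!)%:R * (m + d * #|F|)%:R)^-1 * w eif.2.1.
pose r (eif : E * (I * F)) i :=
  \sum_z f eif.1 i z * (\prod_k v eif.2.1 (z k))^*.
pose s (eif : E * (I * F)) (a : 'I_d) := v eif.2.1 (a, eif.2.2).
have W_ge0 k : 0 <= W k by rewrite mulr_ge0 // invr_ge0 mulr_ge0 ?ler0n.
have SE : rank_one_form W r s eb_approximant.
  move=> i j a b.
  have trE : \sum_e \sum_z f e i z * (f e j z)^* = (i == j)%:R.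
    under eq_bigr do rewrite (sum_pair_sites (fun x u => K _ i x u * (K _ j x u)^*)).
    rewrite exchange_big /=.
    under eq_bigr do rewrite -KT.2.
    rewrite -(sum_sites (fun z => T (delta_mx i j) z z)).
    have [_ _ tpT] := Tch; rewrite [LHS]tpT /mxtrace.
    rewrite -[RHS](sum_delta i (fun k => (k == j)%:R)); apply: eq_bigr => k _.
    by rewrite mxE -natrM mulnb.
  (* The sums over [e], [phi] and [z] trace out everything except the [C^d] component at site
     [i0]. *)
  have margE : \sum_e \sum_phi \sum_(z : {ffun 'I_m -> D} | z i0 == (b, phi))
      f e i (update z i0 (a, phi)) * (f e j z)^* = marginal i0 (T (delta_mx i j)) a b.
    rewrite marginalE; under [RHS]eq_bigr do rewrite KT.2.
    rewrite [RHS]exchange_big; apply: eq_bigr => e _ /=.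
    pose G (x : sitesd) u :=
      if x i0 == b then K e i (set_site x i0 a) u * (K e j x u)^* else 0.
    transitivity (\sum_x \sum_u G x u); last first.
      rewrite [RHS]big_mkcond; apply: eq_bigr => x _; rewrite /G.
      by case: eqP => // _; apply: big1.
    rewrite -sum_pair_sites.
    rewrite (partition_big (fun z : {ffun 'I_m -> D} => (z i0).2) xpredT) //=.
    apply: eq_bigr => phi _; rewrite big_mkcond [RHS]big_mkcond; apply: eq_bigr => z _.
    rewrite /G [p1 z i0]ffunE; case zi0 : (z i0) => [c psi] /=.
    rewrite xpair_eqE; case: (eqVneq c b) => [cb|_] /=; last by case: ifP.
    case: (eqVneq psi phi) => // psiphi; rewrite /f.
    congr (K _ _ _ _ * _); apply/ffunP => k; rewrite !ffunE; case: eqP => //= -> //.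
    by rewrite zi0.
  transitivity (\sum_e \sum_phi ((m`!)%:R * (m + d * #|F|)%:R)^-1 * ((m`!)%:R *
     (((a, phi) == (b, phi) :> D)%:R * (\sum_z f e i z * (f e j z)^*)
      + \sum_k \sum_(z : {ffun 'I_m -> D} | z k == (b, phi))
          f e i (update z k (a, phi)) * (f e j z)^*))); last first.
    rewrite -(pair_bigA _ (fun e ph => W (e, ph) * (r (e, ph) i * (r (e, ph) j)^* ) *
      (s (e, ph) a * (s (e, ph) b)^*))) /=; apply: eq_bigr => e _.
    rewrite -(pair_bigA _ (fun o phi => W (e, (o, phi)) * (r (e, (o, phi)) i *
      (r (e, (o, phi)) j)^* ) * (s (e, (o, phi)) a * (s (e, (o, phi)) b)^*))) /=.
    rewrite exchange_big; apply: eq_bigr => phi _ /=.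
    rewrite -contraction // mulr_sumr; apply: eq_bigr => o _.
    by rewrite /W /r /s /=; ring.
  have mf0 : (m`!)%:R != 0 :> C by rewrite pnatr_eq0 -lt0n fact_gt0.
  transitivity ((m + d * #|F|)%:R^-1 * (#|F|%:R * ((a == b)%:R * (i == j)%:R)
     + m%:R * marginal i0 (T (delta_mx i j)) a b)).
    rewrite eb_approximantE; congr (_ * (_ + _)).
    rewrite -[LHS]mulr_natl [LHS]mulrCA; congr (_ * (_ * _)).
    rewrite /mxtrace -[RHS](sum_delta i (fun k => (k == j)%:R)); apply: eq_bigr => k _.
    by rewrite mxE -natrM mulnb.
  rewrite -trE -margE.
  pose A e := \sum_z f e i z * (f e j z)^*.
  pose B e phi := \sum_(z : {ffun 'I_m -> D} | z i0 == (b, phi))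
    f e i (update z i0 (a, phi)) * (f e j z)^*.
  transitivity (\sum_e \sum_(phi : F)
      (m + d * #|F|)%:R^-1 * ((a == b)%:R * A e + m%:R * B e phi)).
    have -> : #|F|%:R * ((a == b)%:R * \sum_e A e) =
        \sum_e \sum_(phi : F) (a == b)%:R * A e.
      rewrite !mulr_sumr; apply: eq_bigr => e _.
      by rewrite sumr_const mulr_natl.
    rewrite mulr_sumr -big_split mulr_sumr; apply: eq_bigr => e _ /=.
    by rewrite [m%:R * _]mulr_sumr -big_split mulr_sumr.
  apply: eq_bigr => e _; apply: eq_bigr => phi _.
  rewrite (sum_update_site i0) // xpair_eqE eqxx andbT.
  by rewrite invfM -mulrA mulrCA mulKf // mulrC.
split; last exact: rank_one_separable W_ge0 SE.
split=> //; first exact: rank_one_completely_positive linS W_ge0 SE.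
move=> X; rewrite mxtraceZ linearD /= mxtrace_scalar linearZ /= tpM.
rewrite natrD natrM in N0 *.
by rewrite -mulr_natr; field.
Qed.

End Approximant.

(** * Trace norm and risks *)

Section TraceNorm.
Variable R : realType.
Local Notation C := R[i].

Lemma mxtrace_spectral n (A : 'M[C]_n) : psd A ->
  \tr A = \sum_i spectral_diag A 0 i.
Proof.
move=> A_ge0; have [QQ _ _ eA] := nneg_form_spectral A_ge0.
by rewrite [in LHS]eA -mulmxA mxtrace_mulC -mulmxA QQ mulmx1 mxtrace_diag.
Qed.

(** Every singular value is at most the Hilbert-Schmidt norm, and there are [n] of them. *)
Lemma trace_norm_le n (A : 'M[C]_n) (c : R) : 0 <= c ->
  \tr (A ^t* *m A) <= ((c ^+ 2)%:C)%C -> trace_norm A <= n%:R * c.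
Proof.
move=> c_ge0 trA.
have B_ge0 : psd (A ^t* *m A).
  by rewrite -{2}[A]trmxCK; apply: psd_mul_trC.
have [_ _ l_ge0 _] := nneg_form_spectral B_ge0.
rewrite mxtrace_spectral // in trA.
have le_c i : sqrtC (spectral_diag (A ^t* *m A) 0 i) <= (c%:C)%C.
  have c0 : 0 <= (c%:C)%C :> C by rewrite ler0c.
  rewrite -(sqrCK c0) ler_sqrtC ?qualifE /= ?exprn_ge0 // -rmorphXn.
  apply: le_trans trA; rewrite (bigD1 i) //= lerDl; exact: sumr_ge0.
have : \sum_(i < n) sqrtC (spectral_diag (A ^t* *m A) 0 i) <= ((n%:R * c)%:C)%C.
  apply: le_trans (ler_sum _ (fun i _ => le_c i)) _.
  by rewrite sumr_const card_ord mulr_natl rmorphMn.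
by rewrite lecE => /andP[].
Qed.

(** The eigenvalues are nonnegative with sum 1, so each is at most 1 and dominates its square. *)
Lemma purity_le1 n (A : 'M[C]_n) : density A -> \tr (A *m A) <= 1.
Proof.
move=> [A_ge0 trA1]; have [QQ _ l_ge0 eA] := nneg_form_spectral A_ge0.
have sum_l := mxtrace_spectral A_ge0; rewrite trA1 in sum_l.
have -> : \tr (A *m A) = \sum_i spectral_diag A 0 i ^+ 2.
  move: (spectralmx A) (spectral_diag A) QQ eA => Q l QQ eA.
  have -> : A *m A = Q ^t* *m (diag_mx l *m diag_mx l) *m Q.
    by rewrite eA -!mulmxA (mulmxA Q (Q ^t*)) QQ mul1mx.
  rewrite -mulmxA mxtrace_mulC -mulmxA QQ mulmx1; apply: eq_bigr => i _.
  by rewrite mul_diag_mx !mxE eqxx mulr1n.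
rewrite sum_l; apply: ler_sum => i _; rewrite expr2 ler_piMr //.
by rewrite [leRHS]sum_l (bigD1 i) //= lerDl; apply: sumr_ge0.
Qed.

(** The difference is [q / (m + n * q)] times [n *: rho - 1], whose squared Hilbert-Schmidt norm
    [n ^ 2 * \tr (rho *m rho) - n] is at most [n ^ 2] by the purity bound; passing to the trace norm
    costs another factor [n]. *)
Lemma trace_norm_depolarized n (rho : 'M[C]_n) (m q : nat) :
  density rho -> (0 < m)%N ->
  trace_norm (rho - (m + n * q)%:R^-1 *: (q%:R%:M + m%:R *: rho))
    <= q%:R * n%:R ^+ 2 / m%:R.
Proof.
move=> rhoD m_gt0; have [rho_ge0 tr1] := rhoD.
pose k : R := q%:R / (m + n * q)%:R.
have N0 : (m + n * q)%:R != 0 :> C by rewrite pnatr_eq0 -lt0n addn_gt0 m_gt0.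
have -> : rho - (m + n * q)%:R^-1 *: (q%:R%:M + m%:R *: rho) =
    (k%:C)%C *: (n%:R *: rho - 1%:M).
  have -> : (k%:C)%C = q%:R / (m + n * q)%:R :> C.
    by rewrite /k rmorphM fmorphV !rmorph_nat.
  apply/matrixP => a b; move: N0; rewrite natrD natrM => N0.
  by rewrite !mxE !mulrb; case: ifP => _; field.
have k_ge0 : 0 <= k by rewrite divr_ge0 ?ler0n.
apply: le_trans (trace_norm_le (c := k * n%:R) _ _) _; first by rewrite mulr_ge0 ?ler0n.
  set H := n%:R *: rho - 1%:M.
  have HH : H ^t* = H.
    apply/matrixP => a b; rewrite mxE_trC !mxE rmorphB rmorphM /= !conjC_nat.
    by rewrite -mxE_trC (quad_form_ge0_herm rho_ge0) eq_sym.
  have trH : \tr (H *m H) <= n%:R ^+ 2.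
    have -> : \tr (H *m H) = n%:R ^+ 2 * \tr (rho *m rho) - n%:R.
      rewrite /H mulmxBl mulmxBr mul1mx mulmx1 -scalemxAl -scalemxAr.
      by rewrite !raddfB /= !mxtraceZ tr1 mxtrace1; ring.
    apply: le_trans (_ : n%:R ^+ 2 * \tr (rho *m rho) <= _).
      by rewrite gerBl ler0n.
    by rewrite ler_piMr ?purity_le1 // exprn_ge0 ?ler0n.
  have kc : 0 <= (k%:C)%C :> C by rewrite ler0c.
  have -> : ((k%:C)%C *: H) ^t* = (k%:C)%C *: H.
    by rewrite linearZ /= map_mxZ /= HH (geC0_conj kc).
  rewrite -scalemxAl -scalemxAr !mxtraceZ mulrA -expr2.
  have -> : (((k * n%:R) ^+ 2)%:C)%C = (k%:C)%C ^+ 2 * n%:R ^+ 2 :> C.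
    by rewrite rmorphXn rmorphM /= rmorph_nat exprMn.
  by rewrite ler_wpM2l ?exprn_ge0.
rewrite (_ : n%:R * _ = q%:R * n%:R ^+ 2 / (m + n * q)%:R); last by rewrite /k; ring.
rewrite ler_wpM2l ?mulr_ge0 ?exprn_ge0 ?ler0n //.
by rewrite lef_pV2 ?posrE ?ltr0n ?addn_gt0 ?m_gt0 // ler_nat leq_addr.
Qed.

End TraceNorm.

(* The third inequality is what survives of a - b <= a' - b' + delta when the
   differences are undetermined. *)
Lemma lee_sub_shift (R : realType) (a b a' b' : \bar R) (delta : R) :
  (0 <= a -> 0 <= b -> 0 <= a' -> 0 <= b' ->
   a <= a' + delta%:E -> b' <= b + delta%:E -> a + b' <= a' + b + delta%:E ->
   a - b <= a' - b' + delta%:E)%E.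
Proof.
case: b => [b| |] //; last by rewrite addeNy leNye.
case: b' => [b'| |] //; case: a' => [a'| |] //; last by move=> *; apply: leey.
case: a => [a| |] //; rewrite -?EFinN -?EFinD !lee_fin => *; lra.
Qed.

(** Either integral may be infinite, so positive and negative parts are integrated separately and
    recombined by [lee_sub_shift]. *)
Lemma le_integral_shift d (T : measurableType d) (R : realType)
    (P : probability T R) (D : set T) (f g : T -> R) (delta : R) :
  measurable D -> P D = 1%E -> measurable_fun D f -> measurable_fun D g ->
  0 <= delta -> (forall x, D x -> f x <= g x + delta) ->
  (\int[P]_(x in D) (f x)%:E <= \int[P]_(x in D) (g x)%:E + delta%:E)%E.
Proof.
move=> mD PD1 mfr mgr delta_ge0 leL.
have mf : measurable_fun D (EFin \o f) by apply/measurable_EFinP.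
have mg : measurable_fun D (EFin \o g) by apply/measurable_EFinP.
have posneg (h : T -> R) x :
   (((EFin \o h) ^\+ x)%E = (Num.max (h x) 0)%:E) *
   (((EFin \o h) ^\- x)%E = (Num.max (- h x) 0)%:E).
  by split; rewrite ?funeposE ?funenegE EFin_max.
(* For nonnegative functions the integral is additive, and the constant [delta] integrates to itself
   because [P D = 1]. *)
have shift (h k : T -> \bar R) : measurable_fun D h -> measurable_fun D k ->
    (forall x, 0 <= h x)%E -> (forall x, 0 <= k x)%E ->
    (forall x, D x -> h x <= k x + delta%:E)%E ->
    (\int[P]_(x in D) h x <= \int[P]_(x in D) k x + delta%:E)%E.
  move=> mh mk h0 k0 hk.
  have mcst : measurable_fun D (cst delta%:E : T -> \bar R) by [].
  apply: le_trans (_ : (\int[P]_(x in D) (k x + cst delta%:E x) <= _)%E).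
    apply: ge0_le_integral => //; exact: emeasurable_funD.
  rewrite ge0_integralD // integral_cst //.
  suff -> : (delta%:E * P D = delta%:E)%E by [].
  by rewrite PD1 mule1.
have mfp := measurable_funepos mf; have mfn := measurable_funeneg mf.
have mgp := measurable_funepos mg; have mgn := measurable_funeneg mg.
have le_pos : (\int[P]_(x in D) (EFin \o f)^\+ x <=
               \int[P]_(x in D) (EFin \o g)^\+ x + delta%:E)%E.
  apply: shift => // x Dx; rewrite !posneg -EFinD lee_fin.
  have := leL x Dx; move: (f x) (g x) => u v uv.
  by rewrite ge_max /Num.max; case: ltP => ?; apply/andP; split; lra.
have le_neg : (\int[P]_(x in D) (EFin \o g)^\- x <=
               \int[P]_(x in D) (EFin \o f)^\- x + delta%:E)%E.
  apply: shift => // x Dx; rewrite !posneg -EFinD lee_fin.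
  have := leL x Dx; move: (f x) (g x) => u v uv.
  by rewrite ge_max /Num.max; case: ltP => ?; apply/andP; split; lra.
(* The shifted inequality with the negative parts moved across, hence free of undetermined
   differences. *)
have le_sum :
  (\int[P]_(x in D) (EFin \o f)^\+ x + \int[P]_(x in D) (EFin \o g)^\- x <=
   \int[P]_(x in D) (EFin \o g)^\+ x + \int[P]_(x in D) (EFin \o f)^\- x
   + delta%:E)%E.
  rewrite -!ge0_integralD //; apply: shift => [||x|x|x Dx].
  - exact: emeasurable_funD.
  - exact: emeasurable_funD.
  - exact: adde_ge0.
  - exact: adde_ge0.
  rewrite !posneg -!EFinD lee_fin; have := leL x Dx; move: (f x) (g x) => u v uv.
  by rewrite /Num.max; case: ltP => ?; case: ltP => ?; case: ltP => ?;
    case: ltP => ?; lra.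
rewrite integralE [leRHS](congr1 (fun z => z + delta%:E)%E (integralE _ _ _)).
have := integral_ge0 P (fun x (_ : D x) => funepos_ge0 (EFin \o f) x).
have := integral_ge0 P (fun x (_ : D x) => funepos_ge0 (EFin \o g) x).
have := integral_ge0 P (fun x (_ : D x) => funeneg_ge0 (EFin \o f) x).
have := integral_ge0 P (fun x (_ : D x) => funeneg_ge0 (EFin \o g) x).
by move=> ? ? ? ?; apply: lee_sub_shift.
Qed.

Section RiskComparison.
Variables (R : realType) (dA dB : nat).
Variables (X : set 'M[R[i]]_dA) (gamma : 'M[R[i]]_dA -> 'M[R[i]]_dB).
Variables (L : 'M[R[i]]_dB -> 'M[R[i]]_dB -> R) (c : criterion R dA).

Lemma risk_le (S S' : 'M[R[i]]_dA -> 'M[R[i]]_dB) (delta : R) :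
  admissible X gamma L c -> channel S -> channel S' -> 0 <= delta ->
  (forall Sigma, X Sigma ->
     L (gamma Sigma) (S Sigma) <= L (gamma Sigma) (S' Sigma) + delta) ->
  (risk X gamma L c S <= risk X gamma L c S' + delta%:E)%E.
Proof.
case: c => [_ _ _ delta_ge0 leL|G prior [mX X1 mL] Sch S'ch delta_ge0 leL] /=.
  apply: ge_ereal_sup => _ [Sigma XS <-].
  rewrite (le_trans (y := (L (gamma Sigma) (S' Sigma) + delta)%:E)) ?lee_fin ?leL //.
  by rewrite EFinD leeD2r // ereal_sup_ubound //; exists Sigma.
exact: (@le_integral_shift _ (g_sigma_algebraType G) R prior X _ _ delta
  mX X1 (mL S Sch) (mL S' S'ch) delta_ge0 leL).
Qed.

End RiskComparison.

(** * Approximation of protocols by entanglement-breaking channels *)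

Section Discrepancy.
Variables (R : realType) (n m d : nat) (i0 : 'I_m).
Local Notation C := R[i].

(** The approximant errs by at most [#|F| * d ^ 2 / m], that is [d ^ 3 / m] for [F = 'I_d] and
    [d ^ 2 / m] for [F = unit]; both are within [epsilon]. *)
Lemma protocol_eb_approximant sym (T : 'M[C]_n -> 'M[C]_(tdim m d)) :
  protocol sym T -> exists2 S : 'M[C]_n -> 'M[C]_d, eb_channel S &
    forall rho, density rho ->
      trace_norm (marginal i0 (T rho) - S rho) <= epsilon R sym m d.
Proof.
have m_gt0 : (0 < m)%N := leq_ltn_trans (leq0n _) (ltn_ord i0).
move=> [Tch Tsym]; have [_ cpT _] := Tch.
have close (F E : finType) (K : E -> 'I_n -> _ -> {ffun 'I_m -> F} -> C) :
    symmetric_dilation K T -> #|F|%:R * d%:R ^+ 2 / m%:R <= epsilon R sym m d ->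
  exists2 S : 'M[C]_n -> 'M[C]_d, eb_channel S & forall rho, density rho ->
      trace_norm (marginal i0 (T rho) - S rho) <= epsilon R sym m d.
  move=> KT le_eps; exists (eb_approximant i0 F T) => [|rho rhoD].
    exact: eb_approximant_eb_channel Tch KT.
  apply: le_trans le_eps.
  have margD := channel_density (marginal_channel i0 Tch) rhoD.
  have := trace_norm_depolarized #|F| margD m_gt0.
  by rewrite /eb_approximant rhoD.2 mulr1.
case: sym Tsym close => /= Tsym close.
  have [K KT] := exchange_invariant_dilation cpT Tsym.
  apply: close KT _; rewrite card_ord -exprS ler_wpM2r ?invr_ge0 ?ler0n //.
  by rewrite ler_peMl ?exprn_ge0 ?ler0n // ler1n.
have [K KT] := bosonic_dilation cpT Tsym.
apply: close KT _; rewrite card_unit ler_wpM2r ?invr_ge0 ?ler0n //.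
by rewrite ler_wpM2r ?exprn_ge0 ?ler0n // ler1n.
Qed.

End Discrepancy.

Local Open Scope complex_scope.

Theorem theoremS2p3 (R : realType) (dA dB m : nat) (hm : (0 < m)%N)
    (X : set 'M[R[i]]_dA) (gamma : 'M[R[i]]_dA -> 'M[R[i]]_dB)
    (L : 'M[R[i]]_dB -> 'M[R[i]]_dB -> R) (L0 : R)
    (sym : output_symmetry) (c : criterion R dA)
    (hX : X `<=` @density R dA)
    (hgamma : forall Sigma, X Sigma -> density (gamma Sigma))
    (hL0 : 0 <= L0)
    (hL : lipschitz_loss X gamma L L0)
    (hc : admissible X gamma L c) :
  let first_site := Ordinal hm in
  (optimal_one_site_risk X gamma L c sym first_site
     <= optimal_eb_risk X gamma L c)%E /\
  (optimal_eb_risk X gamma L c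
     <= optimal_one_site_risk X gamma L c sym first_site
        + (L0 * dA%:R * epsilon R sym m dB)%:E)%E.
Proof.
move=> i0; split.
  (* Every entanglement-breaking channel is the one-site marginal of some protocol, so its risk is
     also a one-site risk. *)
  apply: le_ereal_inf_tmp => _ [S Sch <-].
  have [T Tprot TS] := eb_channel_product_protocol m sym Sch.
  apply: ereal_inf_lbound; exists T => //.
  by congr (risk X gamma L c); apply/funext => Sigma; apply: TS.
(* The additive constant is finite, so it can be moved across; the bound is then checked protocol by
   protocol. *)
rewrite -leeBlDr //; apply: le_ereal_inf_tmp => _ [T Tprot <-].
have [S Seb close] := protocol_eb_approximant i0 Tprot.
have eps_ge0 : 0 <= epsilon R sym m dB.
  by case: sym {Tprot close} => /=; rewrite divr_ge0 ?mulr_ge0 ?exprn_ge0 ?ler0n.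
rewrite leeBlDr //; apply: le_trans (ereal_inf_lbound _) _; first by exists S.
have Mch := marginal_channel i0 Tprot.1.
apply: (risk_le hc Seb.1 Mch); first by rewrite !mulr_ge0 ?ler0n.
move=> Sigma XS; have rhoD := hX _ XS.
(* The state [Sigma] has trace one, which excludes [dA = 0]; hence [epsilon] is at most
   [dA * epsilon]. *)
have dA_ge1 : 1 <= dA%:R :> R.
  rewrite ler1n lt0n; apply/eqP => dA0; move: rhoD.2; rewrite /mxtrace big1.
    by move/eqP; rewrite eq_sym oner_eq0.
  by move=> i _; have := ltn_ord i; rewrite [X in (_ < X)%N]dA0.
have := hL _ XS _ _ (channel_density Mch rhoD) (channel_density Seb.1 rhoD).
rewrite distrC => /(le_trans (ler_norm _)); rewrite lerBlDl => /le_trans; apply.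
rewrite lerD2l -mulrA ler_wpM2l // (le_trans (close _ rhoD)) //.
by rewrite ler_peMl.
Qed.
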